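(* Let $f:\mathbb{R}^n\to\mathbb{R}$ be twice continuously differentiable with $L$-Lipschitz gradient, let $\varphi_t:\mathbb{R}^{n_t}\to\mathbb{R}$ ($t=1,\dots,p$) be twice continuously differentiable and $\mu_t$-strongly convex with $\mu_t>0$, and let $\mu=\min_t\mu_t$. Let $x^*$ be a strict saddle point of $f$. If $\{x_k\}_{k\ge0}$ is generated by the BMD method with step size $0<\alpha<\frac{\mu}{L}$ from an initial point $x_0$ distributed according to $\nu$, then $$\mathbb{P}_\nu\left[\lim_{k\to\infty}x_k=x^*\right]=0.$$
   Context: $\|\nabla f(x)-\nabla f(y)\|\le L\|x-y\|$ for all $x,y$, with $L>0$. The variable is partitioned as $x=(x(1),\dots,x(p))$, $x(t)\in\mathbb{R}^{n_t}$, $\sum_t n_t=n$; $U_t\in\mathbb{R}^{n\times n_t}$ is the $t$-th block-column of $I_n$ and $\nabla_t f(x)=U_t^T\nabla f(x)$. Strong convexity: $\varphi_t(y)\ge\varphi_t(x)+\langle\nabla\varphi_t(x),y-x\rangle+\frac{\mu_t}{2}\|y-x\|^2$. Bregman divergence: $B_{\varphi_t}(u,v)=\varphi_t(u)-\varphi_t(v)-\langle u-v,\nabla\varphi_t(v)\rangle$. BMD method: given $x_k$, set $x_k^0=x_k$ and for $s=1,\dots,p$ let $x_k^s(s)=\arg\min_{u\in\mathbb{R}^{n_s}}\langle u,\nabla_s f(x_k^{s-1})\rangle+\frac{1}{\alpha}B_{\varphi_s}(u,x_k^{s-1}(s))$ and $x_k^s(t)=x_k^{s-1}(t)$ for $t\neq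 s$; then $x_{k+1}=x_k^p$. A strict saddle is a point $x^*$ with $\nabla f(x^* )=0$ and $\lambda_{\min}(\nabla^2f(x^* ))<0$. $\nu$ is a probability measure on $\mathbb{R}^n$ absolutely continuous with respect to Lebesgue measure. *)

(* Defs.v *)
From HB Require Import structures.
From mathcomp Require Import all_boot all_order all_algebra.
From mathcomp Require Import all_classical all_reals all_analysis.
Set Implicit Arguments. Unset Strict Implicit. Unset Printing Implicit Defensive.
Import Order.TTheory GRing.Theory Num.Theory.
Import numFieldNormedType.Exports.
Local Open Scope classical_set_scope.
Local Open Scope ring_scope.

Section Defs.
Variable R : realType.

Definition dotv m (u v : 'cV[R]_m) : R := \sum_(i < m) u i 0 * v i 0.
Definition enorm m (u : 'cV[R]_m) : R := Num.sqrt (dotv u u).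

Definition grad m (g : 'cV[R]_m -> R) (x : 'cV[R]_m) : 'cV[R]_m :=
  \col_(i < m) 'D_(delta_mx i 0) g x.
Definition hess m (g : 'cV[R]_m -> R) (x : 'cV[R]_m) : 'M[R]_m :=
  \matrix_(i < m, j < m) 'D_(delta_mx j 0) (fun y => grad g y i 0) x.

Definition C2 m (g : 'cV[R]_m -> R) : Prop :=
  [/\ (forall x, differentiable g x),
      (forall x, differentiable (grad g) x),
      continuous (grad g) & continuous (hess g)].

Definition lipschitz_grad m (g : 'cV[R]_m -> R) (L : R) : Prop :=
  forall x y, enorm (grad g x - grad g y) <= L * enorm (x - y).

Definition strongly_convex m (g : 'cV[R]_m -> R) (mu : R) : Prop :=
  forall x y, g y >= g x + dotv (grad g x) (y - x) + mu / 2 * enorm (y - x) ^+ 2.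

Definition bregman m (g : 'cV[R]_m -> R) (u v : 'cV[R]_m) : R :=
  g u - g v - dotv (u - v) (grad g v).

Definition lambda_min m (H : 'M[R]_m) : R := inf [set a | eigenvalue H a].

Definition strict_saddle m (g : 'cV[R]_m -> R) (x : 'cV[R]_m) : Prop :=
  grad g x = 0 /\ lambda_min (hess g x) < 0.

Definition argmin m (F : 'cV[R]_m -> R) : 'cV[R]_m :=
  xget 0 [set u | forall w, F u <= F w].

(* block structure: x = (x(1),...,x(p)), x(t) in R^{ns t} *)
Definition dimn p (ns : 'I_p -> nat) : nat := (\sum_(t < p) ns t)%N.
Definition offset p (ns : 'I_p -> nat) (t : 'I_p) : nat :=
  (\sum_(j < p | (j < t)%N) ns j)%N.
(* U t : t-th block-column of the identity I_n *)
Definition Ublk p (ns : 'I_p -> nat) (t : 'I_p) : 'M[R]_(dimn ns, ns t) :=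
  \matrix_(k < dimn ns, i < ns t) ((k : nat) == (offset ns t + i)%N)%:R.

Definition bmd_block p (ns : 'I_p -> nat) (f : 'cV[R]_(dimn ns) -> R)
    (phi : forall t : 'I_p, 'cV[R]_(ns t) -> R) (alpha : R) (s : 'I_p)
    (x : 'cV[R]_(dimn ns)) : 'cV[R]_(dimn ns) :=
  let xs := (Ublk ns s)^T *m x in
  let gs := (Ublk ns s)^T *m grad f x in
  let u := argmin (fun u => dotv u gs + alpha^-1 * bregman (phi s) u xs) in
  x + Ublk ns s *m (u - xs).

Definition bmd_step p (ns : 'I_p -> nat) f phi alpha (x : 'cV[R]_(dimn ns)) :=
  foldl (fun y s => @bmd_block p ns f phi alpha s y) x (enum 'I_p).

Definition bmd_iter p (ns : 'I_p -> nat) f phi alpha (x0 : 'cV[R]_(dimn ns)) (k : nat) :=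
  iter k (@bmd_step p ns f phi alpha) x0.

(* R^n represented as n.-tuple R for measure theory (product Borel sigma-algebra) *)
Definition tup2cv n (x : n.-tuple R) : 'cV[R]_n := \col_(i < n) tnth x i.

Definition box n (a b : n.-tuple R) : set (n.-tuple R) :=
  [set x | forall i, tnth a i <= tnth x i <= tnth b i].
Definition boxvol n (a b : n.-tuple R) : R := \prod_(i < n) (tnth b i - tnth a i).

Definition lebesgue_null n (A : set (n.-tuple R)) : Prop :=
  forall eps : R, 0 < eps -> exists a b : nat -> n.-tuple R,
    [/\ (forall k i, tnth (a k) i <= tnth (b k) i),
        A `<=` \bigcup_k box (a k) (b k) &
        (\sum_(0 <= k <oo) (boxvol (a k) (b k))%:E <= eps%:E)%E].

Definition abs_cont_lebesgue n (nu : set (n.-tuple R) -> \bar R) : Prop :=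
  forall A, measurable A -> lebesgue_null A -> nu A = 0%E.

End Defs.

(* Main.v *)
Require Import Defs.
From HB Require Import structures.
From mathcomp Require Import all_boot all_order all_algebra.
From mathcomp Require Import all_classical all_reals all_analysis.
From mathcomp Require Import zify ring lra.
Set Implicit Arguments. Unset Strict Implicit. Unset Printing Implicit Defensive.
Import Order.TTheory GRing.Theory Num.Theory.
Import numFieldNormedType.Exports.
Local Open Scope classical_set_scope.
Local Open Scope ring_scope.

(** Let [H] be the Hessian of [f] at the saddle and [q w = w^T H w].  For two
    trajectories near the saddle, a block update changes their difference
    [Delta] by an increment [d] with [D d = - alpha U^T H Delta] up to a small
    multiple of [Delta], where [D] is the Hessian of the block's mirror map.
    This makes [q] drop by at least [L / 2 * |d|^2], while [|H Delta|^2], hence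
    [|q Delta|], is controlled by the sum of the [|d|^2] over a sweep.
    Consequently [Q = q + kappa |.|^2] satisfies
    [Q (g x - g y) <= (1 + eps) Q (x - y)] near the saddle for the sweep [g] and
    suitable small [kappa, eps > 0].  Two orbits that stay near the saddle have
    bounded differences, so [Q (x - y) >= 0] for their starting points.  As
    [Q v < 0] for an eigenvector [v] of a negative eigenvalue of [H], these
    starting points lie on a Lipschitz graph over a hyperplane transverse to
    [v], a null set.  Finally [g] is injective with locally Lipschitz inverse,
    because [alpha L < mu], so the preimages of this set under the iterates of
    [g] are null, and they cover the stable set.  No differentiability of [g]
    and no spectral theory of its derivative is needed. *)

Section Euclid.
Variable R : realType.
Implicit Types m n : nat.

Lemma dotvC m (u v : 'cV[R]_m) : dotv u v = dotv v u.
Proof. by apply: eq_bigr => i _; rewrite mulrC. Qed.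

Lemma dotvE m (u v : 'cV[R]_m) : dotv u v = (u^T *m v) 0 0.
Proof. by rewrite mxE; apply: eq_bigr => i _; rewrite mxE. Qed.

Lemma dotvDl m (u v w : 'cV[R]_m) : dotv (u + v) w = dotv u w + dotv v w.
Proof. by rewrite -big_split; apply: eq_bigr => i _; rewrite mxE mulrDl. Qed.

Lemma dotvDr m (u v w : 'cV[R]_m) : dotv w (u + v) = dotv w u + dotv w v.
Proof. by rewrite dotvC dotvDl !(dotvC w). Qed.

Lemma dotvZl m a (u v : 'cV[R]_m) : dotv (a *: u) v = a * dotv u v.
Proof. by rewrite mulr_sumr; apply: eq_bigr => i _; rewrite mxE mulrA. Qed.

Lemma dotvZr m a (u v : 'cV[R]_m) : dotv u (a *: v) = a * dotv u v.
Proof. by rewrite dotvC dotvZl dotvC. Qed.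

Lemma dotvNl m (u v : 'cV[R]_m) : dotv (- u) v = - dotv u v.
Proof. by rewrite -scaleN1r dotvZl mulN1r. Qed.

Lemma dotvNr m (u v : 'cV[R]_m) : dotv u (- v) = - dotv u v.
Proof. by rewrite dotvC dotvNl dotvC. Qed.

Lemma dotvBl m (u v w : 'cV[R]_m) : dotv (u - v) w = dotv u w - dotv v w.
Proof. by rewrite dotvDl dotvNl. Qed.

Lemma dotvBr m (u v w : 'cV[R]_m) : dotv w (u - v) = dotv w u - dotv w v.
Proof. by rewrite dotvDr dotvNr. Qed.

Lemma dotv0l m (u : 'cV[R]_m) : dotv 0 u = 0.
Proof. by rewrite -(scale0r 0) dotvZl mul0r. Qed.

Lemma dotv_mull m n (A : 'M[R]_(n, m)) (u : 'cV[R]_m) (v : 'cV[R]_n) :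
  dotv (A *m u) v = dotv u (A^T *m v).
Proof. by rewrite !dotvE trmx_mul mulmxA. Qed.

Lemma dotv_delta m (u : 'cV[R]_m) i : dotv u (delta_mx i 0) = u i 0.
Proof.
rewrite /dotv (bigD1 i)//= big1 ?addr0 => [|j ji]; rewrite !mxE !eqxx ?mulr1//.
by rewrite (negPf ji) mulr0.
Qed.

Lemma dotv_ge0 m (u : 'cV[R]_m) : 0 <= dotv u u.
Proof. by apply: sumr_ge0 => i _; rewrite -expr2 sqr_ge0. Qed.

Lemma enorm_ge0 m (u : 'cV[R]_m) : 0 <= enorm u.
Proof. exact: sqrtr_ge0. Qed.

Lemma enorm_sqr m (u : 'cV[R]_m) : enorm u ^+ 2 = dotv u u.
Proof. by rewrite sqr_sqrtr// dotv_ge0. Qed.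

Lemma ler_sqr_le (a b : R) : 0 <= b -> a ^+ 2 <= b ^+ 2 -> a <= b.
Proof.
move=> b0; have [a0|/ltW a0 _] := leP 0 a; last exact: le_trans b0.
by rewrite ler_sqr.
Qed.

Lemma coord_le_enorm m (u : 'cV[R]_m) i : `|u i 0| <= enorm u.
Proof.
apply: ler_sqr_le; first exact: enorm_ge0.
rewrite enorm_sqr real_normK ?num_real// /dotv (bigD1 i)//= -expr2 lerDl.
by apply: sumr_ge0 => j _; rewrite -expr2 sqr_ge0.
Qed.

Lemma enorm_eq0 m (u : 'cV[R]_m) : (enorm u == 0) = (u == 0).
Proof.
apply/eqP/eqP => [u0|->]; last by rewrite /enorm dotv0l sqrtr0.
apply/colP => i; rewrite mxE; apply/eqP; rewrite -normr_le0 -u0.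
exact: coord_le_enorm.
Qed.

Lemma enorm0 m : enorm (0 : 'cV[R]_m) = 0.
Proof. by apply/eqP; rewrite enorm_eq0. Qed.

Lemma cauchy_schwarz m (u v : 'cV[R]_m) : `|dotv u v| <= enorm u * enorm v.
Proof.
apply: ler_sqr_le; first by rewrite mulr_ge0 ?enorm_ge0.
rewrite real_normK ?num_real// exprMn !enorm_sqr.
have [->|v0] := eqVneq v 0; first by rewrite dotvC !dotv0l expr0n/= mulr0.
have vv : 0 < dotv v v.
  rewrite lt_neqAle dotv_ge0 andbT eq_sym -enorm_sqr sqrf_eq0.
  by rewrite enorm_eq0.
have := dotv_ge0 (dotv v v *: u - dotv u v *: v).
rewrite !(dotvBl, dotvBr, dotvZl, dotvZr) (dotvC v u) => H.
by rewrite -subr_ge0 -(pmulr_rge0 _ vv); lra.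
Qed.

Lemma dotv_le m (u v : 'cV[R]_m) : dotv u v <= enorm u * enorm v.
Proof. exact: le_trans (ler_norm _) (cauchy_schwarz _ _). Qed.

Lemma enormD m (u v : 'cV[R]_m) : enorm (u + v) <= enorm u + enorm v.
Proof.
apply: ler_sqr_le; first by rewrite addr_ge0 ?enorm_ge0.
rewrite sqrrD !enorm_sqr dotvDl !dotvDr (dotvC v u).
by have := dotv_le u v; lra.
Qed.

Lemma enormZ m a (u : 'cV[R]_m) : enorm (a *: u) = `|a| * enorm u.
Proof.
apply/eqP; rewrite -(@eqrXn2 _ 2)// ?mulr_ge0 ?enorm_ge0//.
by rewrite exprMn !enorm_sqr real_normK ?num_real// dotvZl dotvZr mulrA.
Qed.

Lemma enormN m (u : 'cV[R]_m) : enorm (- u) = enorm u.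
Proof. by rewrite -scaleN1r enormZ normrN1 mul1r. Qed.

Lemma enormBC m (u v : 'cV[R]_m) : enorm (u - v) = enorm (v - u).
Proof. by rewrite -enormN opprB. Qed.

Lemma enormB m (u v : 'cV[R]_m) : enorm (u - v) <= enorm u + enorm v.
Proof. by rewrite -(enormN v) enormD. Qed.

Lemma enorm_triangle m (v u w : 'cV[R]_m) :
  enorm (u - w) <= enorm (u - v) + enorm (v - w).
Proof. by apply: le_trans (enormD _ _); rewrite addrA subrK. Qed.

Lemma enorm_le_coord m (u : 'cV[R]_m) (K : R) : 0 <= K ->
  (forall i, `|u i 0| <= K) -> enorm u <= m%:R * K.
Proof.
move=> K0 uK; apply: ler_sqr_le; first by rewrite mulr_ge0.
rewrite enorm_sqr /dotv; apply: (@le_trans _ _ (\sum_(i < m) K ^+ 2)).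
  apply: ler_sum => i _; rewrite -expr2 -real_normK ?num_real//.
  by rewrite ler_sqr ?nnegrE.
rewrite sumr_const card_ord -[leLHS]mulr_natl exprMn ler_wpM2r ?sqr_ge0//.
by rewrite -natrX ler_nat; case: m {u uK} => // m; rewrite leq_pmulr.
Qed.

Lemma mulmx_bounded m n (A : 'M[R]_(n, m)) :
  exists2 K, 0 <= K & forall w, enorm (A *m w) <= K * enorm w.
Proof.
exists (n%:R * \sum_i \sum_j `|A i j|) => [|w].
  by rewrite mulr_ge0// sumr_ge0// => i _; apply: sumr_ge0.
rewrite -mulrA; apply: enorm_le_coord => [|i].
  by rewrite mulr_ge0 ?enorm_ge0// sumr_ge0// => i _; apply: sumr_ge0.
rewrite mxE (le_trans (ler_norm_sum _ _ _))//.
apply: (@le_trans _ _ ((\sum_j `|A i j|) * enorm w)).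
  rewrite mulr_suml; apply: ler_sum => j _.
  by rewrite normrM ler_wpM2l// coord_le_enorm.
rewrite ler_wpM2r ?enorm_ge0// (bigD1 i)//= lerDl sumr_ge0// => k _.
exact: sumr_ge0.
Qed.

Lemma mx_entry_le_norm m n (M : 'M[R]_(m, n)) i j : `|M i j| <= `|M|.
Proof.
by rewrite [leRHS]/Num.Def.normr/= mx_normrE; apply: (le_bigmax _ _ (i, j)).
Qed.

Lemma enorm_le_mx_norm m (u : 'cV[R]_m) : enorm u <= m%:R * `|u|.
Proof. by apply: enorm_le_coord => // i; apply: mx_entry_le_norm. Qed.

Lemma mx_norm_le_enorm m (u : 'cV[R]_m) : `|u| <= enorm u.
Proof.
rewrite /Num.Def.normr/= mx_normrE; apply: bigmax_le; first exact: enorm_ge0.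
by case=> i j _; rewrite ord1 coord_le_enorm.
Qed.

End Euclid.

Section Calculus.
Variable R : realType.
Implicit Types m n : nat.

Lemma trmx_continuous m n : continuous (@trmx R m n).
Proof.
move=> x A /= [P nP PA]; exists (fun i j => P j i) => [i j /=|M MP /=].
  by have := nP j i; rewrite mxE.
by apply: PA => i j; rewrite mxE; apply: MP.
Qed.

Lemma cV_box_compact m (r : R) :
  compact [set z : 'cV[R]_m | forall i, - r <= z i 0 <= r].
Proof.
rewrite (_ : [set _ | _] =
   [set z^T | z in [set v : 'rV[R]_m | forall i, `[- r, r]%classic (v ord0 i)]]).
  apply: continuous_compact.
    exact/continuous_subspaceT/trmx_continuous.
  by apply: (@rV_compact _ _ (fun=> `[- r, r]%classic)) => _; apply: segment_compact.
apply/seteqP; split => z /=.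
  by move=> zr; exists z^T; [move=> i; rewrite mxE in_itv/= | rewrite trmxK].
by case=> w wr <- i; have := wr i; rewrite mxE in_itv.
Qed.

Lemma continuous_bounded_ball m n1 n2 (h : 'cV[R]_m -> 'M[R]_(n1, n2)) r :
  continuous h ->
  exists2 K, 0 <= K & forall z, enorm z <= r -> forall i j, `|h z i j| <= K.
Proof.
move=> hc.
have /compact_bounded : compact (h @` [set z : 'cV[R]_m | forall i, - r <= z i 0 <= r]).
  by apply: continuous_compact (@cV_box_compact _ _); apply: continuous_subspaceT.
case=> K [Kr hK]; exists (`|K| + 1) => [|z zr i j]; first by rewrite addr_ge0.
apply: le_trans (mx_entry_le_norm _ _ _) _.
apply: hK; first by rewrite (le_lt_trans (ler_norm K))// ltrDl.
exists z => //= k; rewrite -ler_norml.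
exact: le_trans (coord_le_enorm _ _) zr.
Qed.

Lemma continuous_enorm_near m n1 n2 (h : 'cV[R]_m -> 'M[R]_(n1, n2)) x0 e :
  continuous h -> 0 < e ->
  exists2 r, 0 < r &
    forall z, enorm (z - x0) <= r -> forall i j, `|h z i j - h x0 i j| <= e.
Proof.
move=> hc e0; have /cvgrPdist_le/(_ _ e0)/nbhs_normP [r r0 hr] := hc x0.
exists (r / 2) => [|z zr i j]; first by rewrite divr_gt0.
have xz : `|x0 - z| < r.
  apply: le_lt_trans (mx_norm_le_enorm _) _.
  by rewrite enormBC (le_lt_trans zr)// ltr_pdivrMr// ltr_pMr// ltr1n.
have := mx_entry_le_norm (h x0 - h z) i j; rewrite !mxE distrC.
by move/le_trans; apply; apply: hr.
Qed.

Lemma line_quotient (V W : normedModType R) (G : V -> W) (y v : V) (t : R) :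
  (fun h : R => h^-1 *: (((fun s : R => G (y + s *: v)) \o shift t) (h *: (1 : R))
                        - G (y + t *: v))) =
  (fun h : R => h^-1 *: ((G \o shift (y + t *: v)) (h *: v) - G (y + t *: v))).
Proof.
apply/funext => h; rewrite /= /shift/= [h%:A]mulr1 scalerDl.
by rewrite addrCA.
Qed.

Lemma derive_line (V W : normedModType R) (G : V -> W) (y v : V) (t : R) :
  'D_1 (fun s : R => G (y + s *: v)) t = 'D_v G (y + t *: v).
Proof. by rewrite /derive line_quotient. Qed.

Lemma derivable_line (V W : normedModType R) (G : V -> W) (y v : V) (t : R) :
  derivable G (y + t *: v) v -> derivable (fun s : R => G (y + s *: v)) t 1.
Proof. by rewrite /derivable line_quotient. Qed.

Lemma derive_shiftr (V W : normedModType R) (G : V -> W) (x a v : V) :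
  'D_v (fun z => G (z + a)) x = 'D_v G (x + a).
Proof.
have E : (fun h : R => h^-1 *: (((fun z => G (z + a)) \o shift x) (h *: v)
      - G (x + a))) =
    (fun h : R => h^-1 *: ((G \o shift (x + a)) (h *: v) - G (x + a))).
  by apply/funext => h; rewrite /= /shift/= addrA.
by rewrite /derive E.
Qed.

Lemma derive_grad m (g : 'cV[R]_m -> R) x v :
  differentiable g x -> 'D_v g x = dotv (grad g x) v.
Proof.
move=> dg; rewrite deriveE// {1}(matrix_sum_delta v) linear_sum.
apply: eq_bigr => i _; rewrite big_ord1 linearZ/= mulrC mxE deriveE//.
Qed.

Lemma line_MVT m (G : 'cV[R]_m -> R) x y : (forall z, differentiable G z) ->
  exists2 c : R, 0 <= c <= 1 &
    G x - G y = dotv (grad G (y + c *: (x - y))) (x - y).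
Proof.
move=> dG; pose h (s : R) := G (y + s *: (x - y)).
have dh (t : R) : is_derive t (1 : R) h (dotv (grad G (y + t *: (x - y))) (x - y)).
  apply: DeriveDef; first by apply: derivable_line; apply: diff_derivable.
  by rewrite derive_line derive_grad.
have ch : {within `[0, 1], continuous h}.
  apply: derivable_within_continuous => t _; exact: (@ex_derive _ _ _ _ _ _ _ (dh t)).
have [c c01] := MVT_segment ler01 (fun t _ => dh t) ch.
rewrite /h scale0r addr0 scale1r subr0 mulr1 (addrC y) subrK => ->.
by exists c => //; move: c01; rewrite in_itv.
Qed.

Lemma enorm_segment m (x y x0 : 'cV[R]_m) (c r : R) : 0 <= c <= 1 ->
  enorm (x - x0) <= r -> enorm (y - x0) <= r ->
  enorm (y + c *: (x - y) - x0) <= r.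
Proof.
move=> /andP[c0 c1] xr yr.
have -> : y + c *: (x - y) - x0 = (1 - c) *: (y - x0) + c *: (x - x0).
  by apply/colP => i; rewrite !mxE; ring.
apply: le_trans (enormD _ _) _; rewrite !enormZ !ger0_norm ?subr_ge0//.
have : (1 - c) * enorm (y - x0) <= (1 - c) * r by rewrite ler_wpM2l ?subr_ge0.
have : c * enorm (x - x0) <= c * r by rewrite ler_wpM2l.
lra.
Qed.

Lemma differentiable_mx_coord (V : normedModType R) m n (F : V -> 'M[R]_(m, n))
    x i j : differentiable F x -> differentiable (fun y => F y i j) x.
Proof.
move=> dF; apply: (@differentiable_comp _ _ _ _ F (fun M : 'M[R]_(m, n) => M i j)) => //.
exact: differentiable_coord.
Qed.

Lemma grad_MVT m (g : 'cV[R]_m -> R) x y i : C2 g ->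
  exists2 c : R, 0 <= c <= 1 &
    (grad g x - grad g y) i 0 = (hess g (y + c *: (x - y)) *m (x - y)) i 0.
Proof.
move=> [_ dg _ _].
have [c c01 E] := @line_MVT m (fun z => grad g z i 0) x y
  (fun z => differentiable_mx_coord _ _ (dg z)).
exists c => //; rewrite !mxE in E *; rewrite E.
by apply: eq_bigr => j _; rewrite !mxE.
Qed.

Lemma row_mulmx_le m n (M : 'M[R]_(n, m)) (w : 'cV[R]_m) (K : R) i :
  (forall j, `|M i j| <= K) -> `|(M *m w) i 0| <= m%:R * K * enorm w.
Proof.
move=> MK; rewrite mxE; apply: le_trans (ler_norm_sum _ _ _) _.
apply: (@le_trans _ _ (\sum_(j < m) K * enorm w)).
  apply: ler_sum => j _; rewrite normrM ler_pM//; exact: coord_le_enorm.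
by rewrite sumr_const card_ord -[leLHS]mulr_natl mulrA.
Qed.

Lemma grad_lipschitz_ball m (g : 'cV[R]_m -> R) r : C2 g ->
  exists2 K, 0 <= K & forall x y, enorm x <= r -> enorm y <= r ->
    enorm (grad g x - grad g y) <= K * enorm (x - y).
Proof.
move=> g2; have [_ _ _ hc] := g2.
have [K K0 hK] := @continuous_bounded_ball _ _ _ _ r hc.
exists (m%:R * (m%:R * K)) => [|x y xr yr]; first by rewrite !mulr_ge0.
rewrite -mulrA; apply: enorm_le_coord => [|i].
  by rewrite !mulr_ge0// enorm_ge0.
have [c c01 ->] := grad_MVT x y i g2.
apply: row_mulmx_le => j; apply: hK.
by have := @enorm_segment _ x y 0 c r c01; rewrite !subr0; apply.
Qed.

Lemma grad_strictly_differentiable m (g : 'cV[R]_m -> R) x0 e : C2 g -> 0 < e ->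
  exists2 r, 0 < r & forall x y, enorm (x - x0) <= r -> enorm (y - x0) <= r ->
    enorm (grad g x - grad g y - hess g x0 *m (x - y)) <= e * enorm (x - y).
Proof.
move=> g2 e0; have [_ _ _ hc] := g2.
pose M : R := m.+1%:R; have M0 : 0 < M by rewrite ltr0n.
have mM : m%:R <= M by rewrite ler_nat.
have e'0 : 0 < e / (M * M) by rewrite divr_gt0// mulr_gt0.
have [r r0 hr] := continuous_enorm_near x0 hc e'0.
exists r => // x y xr yr.
apply: (@le_trans _ _ (m%:R * (m%:R * (e / (M * M)) * enorm (x - y)))).
  apply: enorm_le_coord => [|i]; first by rewrite mulr_ge0 ?enorm_ge0// mulr_ge0// ltW.
  have [c c01 E] := grad_MVT x y i g2.
  have -> : (grad g x - grad g y - hess g x0 *m (x - y)) i 0 =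
      ((hess g (y + c *: (x - y)) - hess g x0) *m (x - y)) i 0.
    by rewrite mulmxBl [LHS]mxE [RHS]mxE E.
  apply: row_mulmx_le => j; have := hr _ (enorm_segment c01 xr yr) i j.
  by rewrite [X in _ -> `|X| <= _]mxE [X in _ -> `|_ + X| <= _]mxE.
rewrite !mulrA ler_wpM2r ?enorm_ge0// -[leRHS](mulfVK (lt0r_neq0 (mulr_gt0 M0 M0))).
rewrite -mulrA mulrC ler_wpM2l ?(ltW e'0)//; exact: ler_pM.
Qed.

Lemma second_difference m (g : 'cV[R]_m -> R) x0 (e r : R) (u v : 'cV[R]_m) :
  C2 g ->
  (forall x y, enorm (x - x0) <= r -> enorm (y - x0) <= r ->
    enorm (grad g x - grad g y - hess g x0 *m (x - y)) <= e * enorm (x - y)) ->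
  enorm u + enorm v <= r ->
  `|g (x0 + u + v) - g (x0 + u) - (g (x0 + v) - g x0)
    - dotv u (hess g x0 *m v)| <= e * (enorm u * enorm v).
Proof.
move=> g2 sd uvr; have [dg _ _ _] := g2.
pose G z := g (z + v) - g z.
have dgv z : differentiable (fun z => g (z + v)) z.
  apply: (@differentiable_comp _ _ _ _ (fun z => z + v) g) => //.
have dG z : differentiable G z by apply: differentiableB.
have [c c01 E] := line_MVT (x0 + u) x0 dG.
have xu : x0 + u - x0 = u by rewrite addrAC subrr add0r.
move: E; rewrite {1 2}/G xu => ->.
set z := x0 + c *: u.
have -> : dotv (grad G z) u = dotv (grad g (z + v) - grad g z) u.
  rewrite -derive_grad// deriveB; try exact: diff_derivable.
  by rewrite derive_shiftr !derive_grad// dotvBl.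
have zv : z + v - z = v by rewrite addrAC subrr add0r.
have zr : enorm (z - x0) <= enorm u.
  rewrite /z addrAC subrr add0r enormZ.
  by move: c01 => /andP[c0 c1]; rewrite ger0_norm// ler_piMl// enorm_ge0.
have := sd (z + v) z; rewrite zv => /(_ _ _) H.
rewrite dotvC -dotvBr; apply: le_trans (cauchy_schwarz _ _) _.
rewrite mulrCA ler_wpM2l ?enorm_ge0//; apply: H.
  rewrite addrAC; apply: le_trans (enormD _ _) _.
  by apply: le_trans uvr; rewrite lerD2r.
by apply: le_trans zr _; apply: le_trans uvr; rewrite lerDl enorm_ge0.
Qed.

Lemma small_scale (a r : R) : 0 <= a -> 0 < r -> exists2 t, 0 < t & t * a <= r.
Proof.
move=> a0 r0; have a1 : 0 < a + 1 by rewrite ltr_wpDl.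
exists (r / (a + 1)); first by rewrite divr_gt0.
by rewrite mulrAC ler_pdivrMr// ler_pM2l// lerDl.
Qed.

Lemma hess_sym m (g : 'cV[R]_m -> R) x0 : C2 g -> (hess g x0)^T = hess g x0.
Proof.
move=> g2; set H := hess g x0.
suff key u v : dotv u (H *m v) = dotv v (H *m u).
  apply/matrixP => i j; rewrite mxE.
  have := key (delta_mx i 0) (delta_mx j 0).
  by rewrite !(dotvC (delta_mx _ _)) !dotv_delta -!colE !mxE.
apply/eqP; rewrite -subr_eq0 -normr_le0; apply/ler_addgt0Pr => e e0; rewrite add0r.
have uv0 : 0 <= enorm u * enorm v by rewrite mulr_ge0 ?enorm_ge0.
have [d d0 de] := small_scale uv0 (divr_gt0 e0 (ltr0n _ 2)).
have [r r0 sd] := @grad_strictly_differentiable _ _ x0 _ g2 d0.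
have [t t0 tr] := small_scale (addr_ge0 (enorm_ge0 u) (enorm_ge0 v)) r0.
rewrite mulrDr in tr.
have tu w : enorm (t *: w) = t * enorm w by rewrite enormZ gtr0_norm.
have := @second_difference _ _ _ _ _ (t *: u) (t *: v) g2 sd.
rewrite !tu => /(_ tr) A.
have := @second_difference _ _ _ _ _ (t *: v) (t *: u) g2 sd.
rewrite !tu addrC => /(_ tr); rewrite (addrAC x0) => B.
rewrite -!scalemxAr !(dotvZl, dotvZr) in A B.
move: A B; set s1 := dotv u _; set s2 := dotv v _ => A B.
have t20 : 0 < t * t by rewrite mulr_gt0.
rewrite -(ler_pM2l t20) -{1}(gtr0_norm t20) -normrM.
have : t * t * (d * (enorm u * enorm v)) <= t * t * (e / 2) by rewrite ler_pM2l.
move: A B; rewrite !ler_norml => /andP[A1 A2] /andP[B1 B2] K.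
by apply/andP; split; lra.
Qed.

Lemma hess_approx m (g : 'cV[R]_m -> R) x0 d e : C2 g -> 0 < e ->
  exists2 t, 0 < t &
    enorm (grad g (x0 + t *: d) - grad g x0 - t *: (hess g x0 *m d)) <= e * t.
Proof.
move=> g2 e0; have [e' e'0 He'] := small_scale (enorm_ge0 d) e0.
have [r r0 sd] := @grad_strictly_differentiable _ _ x0 _ g2 e'0.
have [t t0 tr] := small_scale (enorm_ge0 d) r0.
exists t => //; have := sd (x0 + t *: d) x0.
rewrite subrr enorm0 addrAC subrr add0r enormZ gtr0_norm// -scalemxAr.
move=> /(_ tr (ltW r0)) /le_trans; apply.
by rewrite mulrCA mulrC ler_pM2r.
Qed.

Lemma hess_quad_ge m (g : 'cV[R]_m -> R) x0 mu d : C2 g ->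
  (forall x y, mu * enorm (x - y) ^+ 2 <= dotv (grad g x - grad g y) (x - y)) ->
  mu * enorm d ^+ 2 <= dotv d (hess g x0 *m d).
Proof.
move=> g2 mono; apply/ler_addgt0Pr => e e0.
have [e' e'0 He'] := small_scale (enorm_ge0 d) e0.
have [t t0 Ht] := @hess_approx _ _ x0 d _ g2 e'0.
have := mono (x0 + t *: d) x0; rewrite addrAC subrr add0r.
rewrite enormZ gtr0_norm// exprMn dotvZr.
have := dotv_le (grad g (x0 + t *: d) - grad g x0 - t *: (hess g x0 *m d)) d.
rewrite (dotvBl (grad _ _ - grad _ _)) dotvZl.
set s := dotv (_ - _) d; set q := dotv (hess _ _ *m _) _ => A B; rewrite -(ler_pM2l t0).
have C := ler_wpM2r (enorm_ge0 d) Ht.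
have D := ler_wpM2l (ltW t0) He'.
have {}B : mu * (t * enorm d ^+ 2) <= s.
  by rewrite -(ler_pM2l t0); move: B; rewrite expr2; lra.
rewrite dotvC -/q; lra.
Qed.

Lemma hess_quad_le m (g : 'cV[R]_m -> R) x0 L d : C2 g -> lipschitz_grad g L ->
  dotv d (hess g x0 *m d) <= L * enorm d ^+ 2.
Proof.
move=> g2 lip; apply/ler_addgt0Pr => e e0.
have [e' e'0 He'] := small_scale (enorm_ge0 d) e0.
have [t t0 Ht] := @hess_approx _ _ x0 d _ g2 e'0.
have := lip (x0 + t *: d) x0; rewrite addrAC subrr add0r enormZ gtr0_norm// => A.
have A' := ler_wpM2r (enorm_ge0 d) A.
have := dotv_le (- (grad g (x0 + t *: d) - grad g x0 - t *: (hess g x0 *m d))) d.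
rewrite enormN dotvNl (dotvBl (grad _ _ - grad _ _)) dotvZl (dotvC (hess _ _ *m _)).
have := dotv_le (grad g (x0 + t *: d) - grad g x0) d.
set s := dotv (_ - _) d; set q := dotv d _.
move=> B B'; rewrite -(ler_pM2l t0).
have C := ler_wpM2r (enorm_ge0 d) Ht.
have D := ler_wpM2l (ltW t0) He'.
lra.
Qed.

End Calculus.

Section MirrorStep.
Variable R : realType.
Implicit Types m n : nat.

Lemma strongly_monotone m (g : 'cV[R]_m -> R) mu x y : strongly_convex g mu ->
  mu * enorm (x - y) ^+ 2 <= dotv (grad g x - grad g y) (x - y).
Proof.
move=> sc; have := sc x y; have := sc y x.
rewrite (enormBC y x) -(opprB x y) dotvNr dotvBl; lra.
Qed.

Lemma strongly_monotone_enorm m (g : 'cV[R]_m -> R) mu x y :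
  strongly_convex g mu -> mu * enorm (x - y) <= enorm (grad g x - grad g y).
Proof.
move=> sc; have := @strongly_monotone _ _ _ x y sc.
have [xy|xy] := eqVneq (enorm (x - y)) 0; first by rewrite xy mulr0 enorm_ge0.
have xy0 : 0 < enorm (x - y) by rewrite lt_neqAle eq_sym xy enorm_ge0.
move/le_trans => /(_ _ (dotv_le _ _)).
by rewrite expr2 mulrA ler_pM2r.
Qed.

Lemma differentiable_dotvl m (w u : 'cV[R]_m) :
  differentiable (fun v => dotv v w) u.
Proof.
rewrite (_ : (fun v => dotv v w) =
    \sum_(i < m) (w i 0 *: (fun v : 'cV[R]_m => v i 0))); last first.
  by apply/funext => v; rewrite fct_sumE; apply: eq_bigr => i _; rewrite mulrC.
apply: differentiable_sum => i; apply: differentiableZ.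
exact: differentiable_coord.
Qed.

Variables (m : nat) (phi : 'cV[R]_m -> R) (mu alpha : R) (g x : 'cV[R]_m).
Hypotheses (phi2 : C2 phi) (sc : strongly_convex phi mu) (mu0 : 0 < mu).
Hypothesis alpha0 : 0 < alpha.

Let F u := dotv u g + alpha^-1 * bregman phi u x.

Lemma mirror_objective_min : exists c, forall u, F c <= F u.
Proof.
have [dphi _ _ _] := phi2.
have cF : continuous F.
  move=> u; apply: differentiable_continuous.
  apply: differentiableD; first exact: differentiable_dotvl.
  apply: (@differentiableZ _ _ _ (fun u => bregman phi u x) alpha^-1).
  have -> : (fun u => bregman phi u x) =
      (fun u => phi u - dotv u (grad phi x)) + cst (dotv x (grad phi x) - phi x).
    by apply/funext => v; rewrite fctE /cst/= /bregman dotvBl; ring.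
  apply: differentiableD => //; apply: differentiableB => //.
  exact: differentiable_dotvl.
pose rho := 2 * alpha * enorm g / mu.
have rho0 : 0 <= rho.
  by rewrite divr_ge0 ?(ltW mu0)// mulr_ge0 ?enorm_ge0// mulr_ge0// ltW.
pose r := rho + enorm x.
pose B := [set z : 'cV[R]_m | forall i, - r <= z i 0 <= r].
have xB : B x.
  move=> i; rewrite -ler_norml; apply: le_trans (coord_le_enorm _ _) _.
  by rewrite lerDr.
have [c _ cmin] := @compact_EVT_min _ _ F B (ex_intro _ _ xB)
  (@cV_box_compact _ _ _) (continuous_subspaceT cF).
exists c => u; have [uB|uB] := pselect (B u); first exact/cmin/mem_set.
apply: (@le_trans _ _ (F x)); first exact/cmin/mem_set.
have ur : rho <= enorm (u - x).
  rewrite leNgt; apply/negP => ur; apply: uB => i; rewrite -ler_norml.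
  apply: le_trans (coord_le_enorm _ _) _; rewrite /r -(subrK x u).
  by apply: le_trans (enormD _ _) _; rewrite lerD2r ltW.
rewrite -subr_ge0 /F /bregman !subrr dotv0l !subr0 mulr0 addr0.
have scx := sc x u.
have : alpha^-1 * (mu / 2 * enorm (u - x) ^+ 2) <=
    alpha^-1 * (phi u - phi x - dotv (u - x) (grad phi x)).
  rewrite ler_pM2l ?invr_gt0// dotvC; lra.
have := dotv_le (- (u - x)) g; rewrite enormN dotvNl dotvBl.
have : enorm (u - x) * enorm g <= alpha^-1 * (mu / 2 * enorm (u - x) ^+ 2).
  have -> : enorm g = alpha^-1 * (mu / 2) * rho.
    by rewrite /rho; field; rewrite !lt0r_neq0.
  rewrite mulrCA [leRHS]mulrA ler_pM2l ?mulr_gt0 ?invr_gt0// expr2.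
  by rewrite ler_wpM2l ?enorm_ge0.
lra.
Qed.

Lemma mirror_objective_stationary c : (forall u, F c <= F u) ->
  grad phi c = grad phi x - alpha *: g.
Proof.
move=> cmin; have [dphi _ _ _] := phi2.
suff key v : alpha^-1 * dotv (grad phi c) v + dotv v (g - alpha^-1 *: grad phi x) = 0.
  apply/colP => i; have := key (delta_mx i 0).
  rewrite (dotvC (delta_mx _ _)) !dotv_delta.
  move: (grad phi c) (grad phi x) => a b; rewrite !mxE => K.
  have : a i 0 + alpha * g i 0 - b i 0 = 0.
    by rewrite -[RHS](mulr0 alpha) -K; field; rewrite lt0r_neq0.
  lra.
pose k := dotv v (g - alpha^-1 *: grad phi x).
pose h (t : R) := alpha^-1 * phi (c + t *: v) + t * k.
have dh (t : R) : is_derive t (1 : R) h (alpha^-1 * dotv (grad phi (c + t *: v)) v + k).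
  have h1 : is_derive t (1 : R) (fun t => phi (c + t *: v))
      (dotv (grad phi (c + t *: v)) v).
    apply: DeriveDef; first by apply: derivable_line; apply: diff_derivable.
    by rewrite derive_line derive_grad.
  rewrite /h; apply: is_derive_eq.
  by rewrite /GRing.scale/= ?mulr1; ring.
have : is_derive (0 : R) (1 : R) h 0.
  apply: (@derive1_at_min _ h (-1) 1 0).
  - exact: (le_trans (lerN10 R) ler01).
  - by move=> t _; apply: (@ex_derive _ _ _ _ _ _ _ (dh t)).
  - by rewrite in_itv/= ltrN10 ltr01.
  move=> t _; rewrite /h scale0r addr0 mul0r addr0.
  have := cmin (c + t *: v); rewrite /F /bregman /k.
  by rewrite !(dotvBl, dotvBr, dotvDl, dotvZl, dotvZr); lra.
move=> d0; have := @derive_val _ _ _ _ _ _ _ d0.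
by have := @derive_val _ _ _ _ _ _ _ (dh 0) => ->; rewrite scale0r addr0.
Qed.

Lemma grad_argmin :
  grad phi (argmin F) = grad phi x - alpha *: g.
Proof.
apply: mirror_objective_stationary; rewrite /argmin.
by case: xgetP => [u _ //|] H; case: mirror_objective_min => c /H.
Qed.

End MirrorStep.

Section LocallyLipschitz.
Variables (R : realType) (n : nat).
Implicit Types F G : 'cV[R]_n -> 'cV[R]_n.

Definition locally_lipschitz F := forall r, exists2 C, 0 <= C &
  forall x y, enorm x <= r -> enorm y <= r -> enorm (F x - F y) <= C * enorm (x - y).

Definition locally_expanding F := forall r, exists2 C, 0 <= C &
  forall x y, enorm x <= r -> enorm y <= r -> enorm (x - y) <= C * enorm (F x - F y).

Lemma locally_lipschitz_bounded F r : locally_lipschitz F ->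
  exists r', forall x, enorm x <= r -> enorm (F x) <= r'.
Proof.
move=> /(_ r)[C C0 lip]; exists (C * r + enorm (F 0)) => x xr.
rewrite -[F x](subrK (F 0)); apply: le_trans (enormD _ _) _; rewrite lerD2r.
have r0 : 0 <= r := le_trans (enorm_ge0 x) xr.
apply: le_trans (lip _ _ xr _) _; first by rewrite enorm0.
by rewrite subr0 ler_wpM2l.
Qed.

Lemma locally_lipschitz_comp F G : locally_lipschitz F -> locally_lipschitz G ->
  locally_lipschitz (G \o F).
Proof.
move=> lF lG r; have [r' Fr] := locally_lipschitz_bounded r lF.
have [C C0 hF] := lF r; have [C' C'0 hG] := lG r'.
exists (C' * C) => [|x y xr yr /=]; first exact: mulr_ge0.
apply: le_trans (hG _ _ (Fr _ xr) (Fr _ yr)) _.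
by rewrite -mulrA ler_wpM2l// hF.
Qed.

Lemma locally_expanding_comp F G : locally_lipschitz F ->
  locally_expanding F -> locally_expanding G -> locally_expanding (G \o F).
Proof.
move=> lF eF eG r; have [r' Fr] := locally_lipschitz_bounded r lF.
have [C C0 hF] := eF r; have [C' C'0 hG] := eG r'.
exists (C * C') => [|x y xr yr /=]; first exact: mulr_ge0.
apply: le_trans (hF _ _ xr yr) _.
by rewrite -mulrA ler_wpM2l// hG// Fr.
Qed.

Lemma locally_lipschitz_fixpoint F a e : locally_lipschitz F -> F a = a -> 0 < e ->
  exists2 r, 0 < r & forall x, enorm (x - a) <= r -> enorm (F x - a) <= e.
Proof.
move=> /(_ (enorm a + 1))[C C0 hF] Fa e0.
have [t t0 Ct] := small_scale C0 e0.
have t10 : 0 < Num.min t 1 by rewrite lt_min t0 ltr01.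
exists (Num.min t 1) => // x; rewrite le_min => /andP[xt x1].
rewrite -{1}Fa; apply: le_trans (hF _ _ _ _) _.
- by rewrite -(subrK a x) (le_trans (enormD _ _))// addrC lerD2l.
- by rewrite lerDl.
by apply: le_trans Ct; rewrite mulrC ler_wpM2r.
Qed.

End LocallyLipschitz.

Section Block.
Variables (R : realType) (n m : nat) (U : 'M[R]_(n, m)).
Variables (f : 'cV[R]_n -> R) (L : R) (phi : 'cV[R]_m -> R) (mu alpha : R).
Variables (T : 'cV[R]_n -> 'cV[R]_n) (d : 'cV[R]_n -> 'cV[R]_m).
Hypotheses (UU : U^T *m U = 1%:M) (f2 : C2 f) (L0 : 0 < L).
Hypotheses (flip : lipschitz_grad f L) (phi2 : C2 phi).
Hypotheses (mu0 : 0 < mu) (sc : strongly_convex phi mu).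
Hypotheses (alpha0 : 0 < alpha) (alphaL : alpha * L < mu).
Hypothesis TE : forall x, T x = x + U *m d x.
Hypothesis dE : forall x,
  grad phi (U^T *m x + d x) = grad phi (U^T *m x) - alpha *: (U^T *m grad f x).

Lemma enorm_isometry (w : 'cV[R]_m) : enorm (U *m w) = enorm w.
Proof. by rewrite /enorm dotv_mull mulmxA UU mul1mx. Qed.

Lemma enorm_coisometry (x : 'cV[R]_n) : enorm (U^T *m x) <= enorm x.
Proof.
have [->|u0] := eqVneq (enorm (U^T *m x)) 0; first exact: enorm_ge0.
have u1 : 0 < enorm (U^T *m x) by rewrite lt_neqAle eq_sym u0 enorm_ge0.
rewrite -(ler_pM2r u1) -expr2 enorm_sqr dotv_mull trmxK.
by rewrite (le_trans (dotv_le _ _))// enorm_isometry.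
Qed.

Lemma block_coord x : U^T *m T x = U^T *m x + d x.
Proof. by rewrite TE mulmxDr mulmxA UU mul1mx. Qed.

Lemma grad_block x :
  grad phi (U^T *m T x) = grad phi (U^T *m x) - alpha *: (U^T *m grad f x).
Proof. by rewrite block_coord dE. Qed.

Lemma block_diff x y : T x - T y = x - y + U *m (d x - d y).
Proof. by rewrite !TE mulmxBr opprD addrACA. Qed.

Lemma grad_block_diff x y :
  grad phi (U^T *m T x) - grad phi (U^T *m T y) =
  grad phi (U^T *m x) - grad phi (U^T *m y)
  - alpha *: (U^T *m (grad f x - grad f y)).
Proof.
rewrite !grad_block mulmxBr; move: (grad f x) (grad f y) => a b.
move: (U^T *m a) (U^T *m b) (grad phi _) (grad phi _) => a' b' c e.
by apply/colP => i; rewrite !mxE; ring.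
Qed.

Lemma enorm_grad_part x y :
  enorm (alpha *: (U^T *m (grad f x - grad f y))) <= alpha * L * enorm (x - y).
Proof.
rewrite enormZ gtr0_norm// -mulrA ler_pM2l//.
exact: le_trans (enorm_coisometry _) (flip _ _).
Qed.

Lemma block_locally_lipschitz : locally_lipschitz T.
Proof.
move=> r; have [K K0 hK] := @grad_lipschitz_ball _ _ _ r phi2.
pose C := (K + alpha * L) / mu.
have C0 : 0 <= C by rewrite divr_ge0 ?(ltW mu0)// addr_ge0// ltW// mulr_gt0.
exists (C + 2) => [|x y xr yr]; first by rewrite addr_ge0.
have A : enorm (U^T *m (T x - T y)) <= C * enorm (x - y).
  rewrite /C mulrAC ler_pdivlMr// mulrC mulmxBr.
  apply: le_trans (strongly_monotone_enorm _ _ sc) _.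
  rewrite grad_block_diff; apply: le_trans (enormB _ _) _.
  rewrite mulrDl lerD ?enorm_grad_part//.
  apply: le_trans (hK _ _ _ _) _; rewrite ?(le_trans (enorm_coisometry _))//.
  by rewrite -mulmxBr ler_wpM2l// enorm_coisometry.
have B : enorm (U *m (d x - d y)) <= (C + 1) * enorm (x - y).
  rewrite enorm_isometry (_ : d x - d y = U^T *m (T x - T y) - U^T *m (x - y)).
    apply: le_trans (enormB _ _) _; rewrite mulrDl mul1r lerD//.
    exact: enorm_coisometry.
  by rewrite block_diff mulmxDr mulmxA UU mul1mx addrAC subrr add0r.
rewrite block_diff; apply: le_trans (enormD _ _) _; lra.
Qed.

Lemma block_locally_expanding : locally_expanding T.
Proof.
move=> r; have [r' Tr] := locally_lipschitz_bounded r block_locally_lipschitz.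
have [K K0 hK] := @grad_lipschitz_ball _ _ _ r' phi2.
have gap : 0 < mu - alpha * L by rewrite subr_gt0.
have aL : 0 < alpha * L by rewrite mulr_gt0.
pose C := (K + 2 * (alpha * L)) / (mu - alpha * L).
have C0 : 0 <= C by rewrite divr_ge0 ?(ltW gap)// addr_ge0// mulr_ge0// ltW.
exists (C + 2) => [|x y xr yr]; first by rewrite addr_ge0.
set D := x - y; set D' := T x - T y.
(* the components outside the block are unchanged *)
have off : D - U *m (U^T *m D) = D' - U *m (U^T *m D').
  rewrite /D' block_diff -/D (mulmxDr U^T D) (mulmxA U^T U) UU mul1mx mulmxDr opprD.
  by rewrite addrACA subrr addr0.
have DD : enorm D <= enorm (U^T *m D) + 2 * enorm D'.
  rewrite -{1}(subrK (U *m (U^T *m D)) D) off addrC.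
  apply: le_trans (enormD _ _) _; rewrite enorm_isometry lerD2l.
  apply: le_trans (enormB _ _) _; rewrite enorm_isometry.
  by have := enorm_coisometry D'; lra.
have mono : mu * enorm (U^T *m D) <= K * enorm D' + alpha * L * enorm D.
  rewrite {1}/D mulmxBr; apply: le_trans (strongly_monotone_enorm _ _ sc) _.
  rewrite -[X in enorm X](subrK (alpha *: (U^T *m (grad f x - grad f y)))).
  rewrite -grad_block_diff; apply: le_trans (enormD _ _) _.
  rewrite lerD ?enorm_grad_part//.
  apply: le_trans (hK _ _ _ _) _; rewrite ?(le_trans (enorm_coisometry _)) ?Tr//.
  by rewrite -mulmxBr ler_wpM2l// enorm_coisometry.
have : alpha * L * enorm D <= alpha * L * (enorm (U^T *m D) + 2 * enorm D').
  by rewrite ler_pM2l.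
move=> K1; have : enorm (U^T *m D) <= C * enorm D'.
  rewrite /C mulrAC ler_pdivlMr//; lra.
lra.
Qed.

Lemma block_fixpoint a : grad f a = 0 -> T a = a.
Proof.
move=> ga; suff E : d a = 0 by rewrite TE E mulmx0 addr0.
apply/eqP; rewrite -enorm_eq0; apply/eqP.
have := @strongly_monotone_enorm _ _ _ _ (U^T *m a + d a) (U^T *m a) sc.
rewrite dE ga mulmx0 scaler0 subr0 subrr enorm0 addrAC subrr add0r.
by rewrite pmulr_rle0// => A; apply/eqP; rewrite eq_le A enorm_ge0.
Qed.

Variable a : 'cV[R]_n.
Hypothesis fa : grad f a = 0.
Let H := hess f a.
Let D := hess phi (U^T *m a).

Lemma block_linearization delta : 0 < delta -> exists2 r, 0 < r &
  forall x y, enorm (x - a) <= r -> enorm (y - a) <= r ->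
  enorm (D *m (d x - d y) + alpha *: (U^T *m (H *m (x - y))))
    <= delta * enorm (x - y).
Proof.
move=> delta0.
have [C C0 hC] := block_locally_lipschitz (enorm a + 1).
have [e e0 He] := small_scale (addr_ge0 (addr_ge0 C0 ler01) (ltW alpha0)) delta0.
have [r1 r10 sphi] := @grad_strictly_differentiable _ _ _ (U^T *m a) _ phi2 e0.
have [r2 r20 sf] := @grad_strictly_differentiable _ _ _ a _ f2 e0.
have [r3 r30 Tr] :=
  locally_lipschitz_fixpoint block_locally_lipschitz (block_fixpoint fa) r10.
pose r := Num.min (Num.min r1 r2) (Num.min r3 1).
have r0 : 0 < r by rewrite !lt_min r10 r20 r30 ltr01.
exists r => // x y; rewrite !le_min.
move=> /andP[/andP[x1 x2] /andP[x3 x4]] /andP[/andP[y1 y2] /andP[y3 y4]].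
have ball z : enorm (z - a) <= 1 -> enorm z <= enorm a + 1.
  by move=> za; rewrite -(subrK a z) (le_trans (enormD _ _))// addrC lerD2l.
have Ublk z w : enorm (z - w) <= r1 -> enorm (U^T *m z - U^T *m w) <= r1.
  by move=> ?; rewrite -mulmxBr (le_trans (enorm_coisometry _)).
have E1 := sphi (U^T *m T x) (U^T *m T y) (Ublk _ _ (Tr _ x3)) (Ublk _ _ (Tr _ y3)).
have E2 := sphi (U^T *m x) (U^T *m y) (Ublk _ _ x1) (Ublk _ _ y1).
have E3 := sf x y x2 y2.
move: E1 E2 E3; rewrite grad_block_diff -!mulmxBr -/D -/H.
set P := grad phi _ - grad phi _; set G := grad f x - grad f y.
pose e1 := P - alpha *: (U^T *m G) - D *m (U^T *m (T x - T y)).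
pose e2 := P - D *m (U^T *m (x - y)); pose e3 := G - H *m (x - y).
rewrite -/e1 -/e2 -/e3 => E1 E2 E3.
have -> : D *m (d x - d y) + alpha *: (U^T *m (H *m (x - y))) =
    e2 - e1 - alpha *: (U^T *m e3).
  rewrite /e1 /e2 /e3 (block_diff x y) (mulmxDr U^T (x - y)) (mulmxA U^T U) UU.
  rewrite mul1mx (mulmxDr D (U^T *m (x - y))) (mulmxBr U^T G).
  have alg (p g s t u : 'cV[R]_m) : p + alpha *: s =
      u - t - (u - alpha *: g - (t + p)) - alpha *: (g - s).
    by apply/colP => i; rewrite !mxE; ring.
  exact: alg.
apply: le_trans (enormB _ _) _; rewrite enormZ gtr0_norm//.
have F1 := enormB e2 e1.
have F3 : alpha * enorm (U^T *m e3) <= alpha * (e * enorm (x - y)).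
  by rewrite ler_pM2l// (le_trans (enorm_coisometry _)).
have F2 : e * enorm (U^T *m (x - y)) <= e * enorm (x - y).
  by rewrite ler_pM2l// enorm_coisometry.
have F4 : e * enorm (U^T *m (T x - T y)) <= e * (C * enorm (x - y)).
  rewrite ler_pM2l// (le_trans (enorm_coisometry _))// hC// ball//.
have := ler_wpM2r (enorm_ge0 (x - y)) He; lra.
Qed.

Let q (w : 'cV[R]_n) := dotv w (H *m w).

Lemma block_energy : exists2 C, 0 <= C & forall eta, 0 < eta ->
  exists2 r, 0 < r &
  forall x y, enorm (x - a) <= r -> enorm (y - a) <= r ->
  [/\ q (T x - T y) <= q (x - y) - L / 2 * enorm (d x - d y) ^+ 2
                       + eta * enorm (x - y) ^+ 2,
      enorm (T x - T y - (x - y)) ^+ 2 = enorm (d x - d y) ^+ 2 &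
      enorm (U^T *m (H *m (x - y))) ^+ 2 <=
        C * enorm (d x - d y) ^+ 2 + eta * enorm (x - y) ^+ 2].
Proof.
have [K K0 hK] := mulmx_bounded D.
exists (2 * (K / alpha) ^+ 2) => [|eta eta0]; first by rewrite mulr_ge0// sqr_ge0.
have c0 : 0 < eta * Num.min 1 L by rewrite mulr_gt0// lt_min ltr01.
have [s s0 hs] : exists2 s : R, 0 < s & 2 * s ^+ 2 <= eta * Num.min 1 L.
  exists (Num.min 1 (eta * Num.min 1 L / 2)); first by rewrite lt_min ltr01 divr_gt0.
  set s := Num.min _ _; have s1 : s <= 1 by rewrite ge_min lexx.
  have s2 : s <= eta * Num.min 1 L / 2 by rewrite ge_min lexx orbT.
  have s0 : 0 <= s by rewrite le_min ler01 divr_ge0// ltW.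
  have : s ^+ 2 <= s by rewrite expr2 ler_piMl.
  lra.
have hs1 : 2 * s ^+ 2 <= eta.
  by apply: le_trans hs _; rewrite ger_pMr// ge_min lexx.
have hs2 : 2 * s ^+ 2 <= eta * L.
  by apply: le_trans hs _; rewrite ler_pM2l// ge_min lexx orbT.
have [r r0 lin] := block_linearization (mulr_gt0 alpha0 s0).
exists r => // x y xr yr; have := lin x y xr yr.
set Delta := x - y; set dd := d x - d y; set z := U^T *m (H *m Delta).
set N := enorm Delta; set e := D *m dd + alpha *: z; set E := enorm dd => le.
have N0 : 0 <= N := enorm_ge0 _.
have E0 : 0 <= E := enorm_ge0 _.
split; last first.
- have zE : alpha *: z = e - D *m dd by rewrite /e addrAC subrr add0r.
  have : alpha * enorm z <= alpha * s * N + K * E.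
    rewrite -{1}(gtr0_norm alpha0) -enormZ zE.
    by apply: le_trans (enormB _ _) _; rewrite lerD.
  move=> zN; have {}zN : enorm z <= s * N + K / alpha * E.
    rewrite -(ler_pM2l alpha0) mulrDr !mulrA (mulrC alpha K) mulfK//.
    by rewrite lt0r_neq0.
  have zN2 : enorm z ^+ 2 <= (s * N + K / alpha * E) ^+ 2.
    by rewrite ler_sqr ?nnegrE ?enorm_ge0// (le_trans (enorm_ge0 z)).
  have : 2 * s ^+ 2 * N ^+ 2 <= eta * N ^+ 2 by rewrite ler_wpM2r ?sqr_ge0.
  have := sqr_ge0 (s * N - K / alpha * E); move: zN2.
  move: (K / alpha) => k; rewrite sqrrB sqrrD !exprMn; lra.
- by rewrite block_diff addrAC subrr add0r enorm_isometry.
rewrite block_diff -/Delta -/dd /q.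
have -> : dotv (Delta + U *m dd) (H *m (Delta + U *m dd)) =
    dotv Delta (H *m Delta) + 2 * dotv dd z + dotv (U *m dd) (H *m (U *m dd)).
  rewrite (mulmxDr H Delta) (dotvDl Delta) !(dotvDr (H *m Delta)).
  rewrite (dotv_mull U dd (H *m Delta)) -/z.
  have -> : dotv Delta (H *m (U *m dd)) = dotv dd z.
    by rewrite dotvC dotv_mull hess_sym// dotv_mull.
  ring.
have P1 := @hess_quad_le _ _ _ a _ (U *m dd) f2 flip.
rewrite enorm_isometry -/H -/E in P1.
have P2 := @hess_quad_ge _ _ _ (U^T *m a) _ dd phi2
  (fun x y => strongly_monotone _ _ sc).
rewrite -/D -/E in P2.
have P3 : alpha * dotv dd z <= alpha * (s * N * E - L * E ^+ 2).
  have -> : alpha * dotv dd z = dotv dd e - dotv dd (D *m dd).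
    by rewrite /e dotvDr dotvZr; ring.
  have := dotv_le dd e; have := ler_wpM2l E0 le.
  have : alpha * L * E ^+ 2 <= mu * E ^+ 2 by rewrite ler_wpM2r ?sqr_ge0// ltW.
  rewrite -/E; lra.
rewrite ler_pM2l// in P3.
have P4 : 2 * (s * N * E) <= L / 2 * E ^+ 2 + eta * N ^+ 2.
  rewrite -(ler_pM2l L0).
  have := sqr_ge0 (L * E - 2 * s * N); rewrite sqrrB !exprMn.
  have : 2 * s ^+ 2 * N ^+ 2 <= eta * L * N ^+ 2 by rewrite ler_wpM2r ?sqr_ge0.
  lra.
lra.
Qed.

End Block.

Section Blocks.
Variables (R : realType) (p : nat) (ns : 'I_p -> nat).

Lemma offsetS (t : 'I_p) :
  (offset ns t + ns t = \sum_(j < p | (j < t.+1)%N) ns j)%N.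
Proof.
rewrite [RHS](bigD1 t)//= addnC /offset; congr (_ + _)%N.
by apply: eq_bigl => j; rewrite ltnS ltn_neqAle andbC.
Qed.

Lemma offset_lt (t : 'I_p) (i : 'I_(ns t)) : (offset ns t + i < dimn ns)%N.
Proof.
apply: (@leq_trans (offset ns t + ns t)); first by rewrite ltn_add2l.
by rewrite offsetS /dimn [leqRHS](bigID (fun j : 'I_p => (j < t.+1)%N))/= leq_addr.
Qed.

Lemma offset_surj (k : 'I_(dimn ns)) :
  exists (t : 'I_p) (i : 'I_(ns t)), (k = offset ns t + i :> nat)%N.
Proof.
suff key (t : nat) : (t <= p)%N -> (k < \sum_(j < p | (j < t)%N) ns j)%N ->
    exists (t : 'I_p) (i : 'I_(ns t)), (k = offset ns t + i :> nat)%N.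
  apply: (key p) => //; apply: leq_trans (ltn_ord k) _.
  by rewrite leq_eqVlt; apply/orP; left; apply/eqP; apply: eq_bigl => j; rewrite ltn_ord.
elim: t => [_|t IH tp]; first by rewrite big_pred0.
rewrite -(offsetS (Ordinal tp)) => kt.
have [kt'|kt'] := ltnP k (offset ns (Ordinal tp)); first exact: IH (ltnW tp) kt'.
have kn : (k - offset ns (Ordinal tp) < ns (Ordinal tp))%N by rewrite ltn_subLR.
by exists (Ordinal tp), (Ordinal kn); rewrite /= subnKC.
Qed.

Lemma UblkT_mul (t : 'I_p) (i : 'I_(ns t)) (k : 'I_(dimn ns)) (w : 'cV[R]_(dimn ns)) :
  (k = offset ns t + i :> nat)%N -> ((Ublk R ns t)^T *m w) i 0 = w k 0.
Proof.
move=> ki; rewrite mxE (bigD1 k)//= big1 ?addr0 => [|j jk]; rewrite !mxE.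
  by rewrite ki eqxx mul1r.
by rewrite -ki (negPf (jk : (j : nat) != k)) mul0r.
Qed.

Lemma Ublk_orthonormal (t : 'I_p) : (Ublk R ns t)^T *m Ublk R ns t = 1%:M.
Proof.
apply/matrixP => i j; rewrite !mxE (bigD1 (Ordinal (offset_lt i)))//= big1.
  by rewrite addr0 !mxE eqxx mul1r eqn_add2l.
move=> k ki; rewrite !mxE; have -> : (k == offset ns t + i :> nat)%N = false.
  exact: negbTE.
by rewrite mul0r.
Qed.

Lemma enorm_sqr_le_blocks (w : 'cV[R]_(dimn ns)) (B : R) :
  (forall t, enorm ((Ublk R ns t)^T *m w) ^+ 2 <= B) ->
  enorm w ^+ 2 <= (dimn ns)%:R * B.
Proof.
move=> wB; rewrite enorm_sqr mulr_natl -[in leRHS](card_ord (dimn ns)) -sumr_const.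
apply: ler_sum => k _; have [t [i ki]] := offset_surj k.
apply: le_trans (wB t); rewrite -(UblkT_mul w ki) -expr2 -real_normK ?num_real//.
by rewrite ler_sqr ?nnegrE ?enorm_ge0// coord_le_enorm.
Qed.

End Blocks.

Lemma enorm_sqrD_le (R : realType) m (u v : 'cV[R]_m) :
  enorm (u + v) ^+ 2 <= 2 * enorm u ^+ 2 + 2 * enorm v ^+ 2.
Proof.
have := dotv_ge0 (u - v); rewrite !enorm_sqr !(dotvBl, dotvDl, dotvBr, dotvDr).
by rewrite (dotvC v u); lra.
Qed.

Lemma enorm_sqrB_le (R : realType) m (u v : 'cV[R]_m) :
  enorm (u - v) ^+ 2 <= 2 * enorm u ^+ 2 + 2 * enorm v ^+ 2.
Proof. by rewrite -(enormN v) enorm_sqrD_le. Qed.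

Lemma ball_enorm_le (R : realType) m (z a : 'cV[R]_m) r :
  enorm (z - a) <= r -> enorm z <= enorm a + r.
Proof.
by move=> za; rewrite -(subrK a z) (le_trans (enormD _ _))// addrC lerD2l.
Qed.

Section Sweep.
Variables (R : realType) (p : nat) (ns : 'I_p -> nat).
Variables (f : 'cV[R]_(dimn ns) -> R) (L : R).
Variables (phi : forall t : 'I_p, 'cV[R]_(ns t) -> R) (mus : 'I_p -> R) (alpha : R).
Arguments phi : clear implicits.
Hypotheses (f2 : C2 f) (L0 : 0 < L) (flip : lipschitz_grad f L).
Hypotheses (phi2 : forall t, C2 (phi t)) (mu0 : forall t, 0 < mus t).
Hypothesis sc : forall t, strongly_convex (phi t) (mus t).
Arguments sc : clear implicits.
Hypotheses (alpha0 : 0 < alpha) (alphaL : forall t, alpha * L < mus t).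

Let U t := Ublk R ns t.
Let T t := bmd_block f phi alpha t.

Let d t x : 'cV[R]_(ns t) :=
  argmin (fun u => dotv u ((U t)^T *m grad f x)
                   + alpha^-1 * bregman (phi t) u ((U t)^T *m x)) - (U t)^T *m x.

Lemma bmd_blockE t x : T t x = x + U t *m d t x.
Proof. by []. Qed.

Lemma bmd_block_grad t x : grad (phi t) ((U t)^T *m x + d t x) =
  grad (phi t) ((U t)^T *m x) - alpha *: ((U t)^T *m grad f x).
Proof. by rewrite /d addrC subrK (grad_argmin _ _ (phi2 t) (sc t)). Qed.

Lemma bmd_block_locally_lipschitz t : locally_lipschitz (T t).
Proof.
exact: (block_locally_lipschitz (Ublk_orthonormal R ns t) L0 flip (phi2 t) (mu0 t)
  (sc t) alpha0 (bmd_blockE t) (bmd_block_grad t)).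
Qed.

Lemma bmd_block_locally_expanding t : locally_expanding (T t).
Proof.
exact: (block_locally_expanding (Ublk_orthonormal R ns t) L0 flip (phi2 t) (mu0 t)
  (sc t) alpha0 (alphaL t) (bmd_blockE t) (bmd_block_grad t)).
Qed.

Let sweep (l : seq 'I_p) x := foldl (fun y s => T s y) x l.

Lemma sweep_rcons l t : sweep (rcons l t) = T t \o sweep l.
Proof. by apply/funext => x; rewrite /sweep foldl_rcons. Qed.

Lemma sweep_locally_lipschitz l : locally_lipschitz (sweep l).
Proof.
elim/last_ind: l => [r|l t IH]; first by exists 1 => // x y; rewrite mul1r.
by rewrite sweep_rcons; apply: locally_lipschitz_comp (bmd_block_locally_lipschitz t).
Qed.

Lemma sweep_locally_expanding l : locally_expanding (sweep l).
Proof.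
elim/last_ind: l => [r|l t IH]; first by exists 1 => // x y; rewrite mul1r.
rewrite sweep_rcons; apply: locally_expanding_comp => //.
  exact: sweep_locally_lipschitz.
exact: bmd_block_locally_expanding.
Qed.

Variable a : 'cV[R]_(dimn ns).
Hypothesis fa : grad f a = 0.
Let H := hess f a.
Let q (w : 'cV[R]_(dimn ns)) := dotv w (H *m w).

Lemma sweep_fixpoint l : sweep l a = a.
Proof.
elim/last_ind: l => [//|l t IH]; rewrite sweep_rcons/= IH.
exact: (block_fixpoint (mu0 t) (sc t) (bmd_blockE t) (bmd_block_grad t) fa).
Qed.

(* [S] stands for the sum of the squared block increments of the difference of
   two trajectories. *)
Lemma sweep_energy l : exists2 C, 0 <= C & forall eta, 0 < eta ->
  exists2 r, 0 < r &
  forall x y, enorm (x - a) <= r -> enorm (y - a) <= r ->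
  exists2 S, 0 <= S &
  [/\ q (sweep l x - sweep l y) <= q (x - y) - L / 2 * S + eta * enorm (x - y) ^+ 2,
      enorm (sweep l x - sweep l y - (x - y)) ^+ 2 <= C * S &
      forall t, t \in l ->
        enorm ((U t)^T *m (H *m (x - y))) ^+ 2 <= C * S + eta * enorm (x - y) ^+ 2].
Proof.
elim/last_ind: l => [|l t [C C0 IH]].
  exists 0 => // eta eta0; exists 1 => // x y _ _; exists 0 => //; split=> //=.
    by rewrite mulr0 subr0 lerDl mulr_ge0 ?sqr_ge0// ltW.
  by rewrite subrr enorm0 mul0r expr0n.
have [Cb Cb0 hb] := block_energy (Ublk_orthonormal R ns t) f2 L0 flip (phi2 t) (mu0 t)
  (sc t) alpha0 (alphaL t) (bmd_blockE t) (bmd_block_grad t) fa.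
have [KH KH0 hH] := mulmx_bounded ((U t)^T *m H).
have [K K0 hK] := sweep_locally_lipschitz l (enorm a + 1).
pose C' := 2 * C + 2 + 2 * Cb + 2 * (KH ^+ 2 * C).
have KC : 0 <= KH ^+ 2 * C by rewrite mulr_ge0// sqr_ge0.
exists C' => [|eta eta0]; first by rewrite !addr_ge0// mulr_ge0.
have eta20 : 0 < eta / 2 by rewrite divr_gt0.
have [r1 r10 h1] := IH _ eta20.
have [eta2 eta2p heta2] := small_scale (sqr_ge0 K) eta20.
have [r2 r20 h2] := hb _ eta2p.
have [r3 r30 h3] :=
  locally_lipschitz_fixpoint (sweep_locally_lipschitz l) (sweep_fixpoint l) r20.
pose r := Num.min r1 (Num.min r3 1).
exists r; first by rewrite !lt_min r10 r30 ltr01.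
move=> x y; rewrite !le_min => /andP[x1 /andP[x3 x4]] /andP[y1 /andP[y3 y4]].
have [S S0 [q1 n1 u1]] := h1 x y x1 y1.
have [q2 n2 u2] := h2 _ _ (h3 _ x3) (h3 _ y3).
have {}hK := hK x y (ball_enorm_le x4) (ball_enorm_le y4).
rewrite sweep_rcons /=; move: q1 n1 u1 q2 n2 u2 hK.
rewrite -/(T t) -/(U t) -/H -/(q _) -/(q _).
move: (sweep l x) (sweep l y) => x' y'.
set E := enorm (d t x' - d t y') ^+ 2; set N := enorm (x - y) ^+ 2.
move=> q1 n1 u1 q2 n2 u2 hK.
have N0 : 0 <= N := sqr_ge0 _.
have E0 : 0 <= E := sqr_ge0 _.
have N' : eta2 * enorm (x' - y') ^+ 2 <= eta / 2 * N.
  apply: (@le_trans _ _ (eta2 * (K ^+ 2 * N))).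
    rewrite ler_pM2l// -exprMn ler_sqr ?nnegrE ?mulr_ge0 ?enorm_ge0//.
  by rewrite mulrA ler_wpM2r.
have CE : 0 <= C * E by rewrite mulr_ge0.
have CS : 0 <= C * S by rewrite mulr_ge0.
have CbE : 0 <= Cb * E by rewrite mulr_ge0.
have CbS : 0 <= Cb * S by rewrite mulr_ge0.
have KS : 0 <= KH ^+ 2 * C * S by rewrite mulr_ge0.
have KE : 0 <= KH ^+ 2 * C * E by rewrite mulr_ge0.
exists (S + E); first by rewrite addr_ge0.
split.
- by apply: le_trans q2 _; lra.
- rewrite -(subrK (x' - y') (T t x' - T t y')) -addrA.
  apply: le_trans (enorm_sqrD_le _ _) _; rewrite n2 /C'; lra.
move=> s; rewrite mem_rcons inE => /orP[/eqP ->|sl]; last first.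
  by apply: le_trans (u1 _ sl) _; rewrite /C'; have := mulr_ge0 (ltW eta20) N0; lra.
have -> : (U t)^T *m (H *m (x - y)) = (U t)^T *m (H *m (x' - y'))
    - ((U t)^T *m H) *m (x' - y' - (x - y)).
  by rewrite -mulmxA -!mulmxBr opprB addrCA subrr addr0.
apply: le_trans (enorm_sqrB_le _ _) _.
have : enorm (((U t)^T *m H) *m (x' - y' - (x - y))) ^+ 2 <= KH ^+ 2 * (C * S).
  apply: (@le_trans _ _ ((KH * enorm (x' - y' - (x - y))) ^+ 2)).
    by rewrite ler_sqr ?nnegrE ?mulr_ge0 ?enorm_ge0.
  by rewrite exprMn ler_wpM2l ?sqr_ge0.
move: u2; rewrite /C'; lra.
Qed.

End Sweep.

Section Lyapunov.
Variables (R : realType) (n : nat) (H : 'M[R]_n).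
Hypothesis Hsym : H^T = H.
Let q (w : 'cV[R]_n) := dotv w (H *m w).

(* Writing [H = H G H] with a generalized inverse [G] gives [q w = (H w)^T G (H w)]. *)
Lemma sym_quad_le_image : exists2 C, 0 <= C & forall w, `|q w| <= C * enorm (H *m w) ^+ 2.
Proof.
have [C C0 hC] := mulmx_bounded (pinvmx H); exists C => // w.
have -> : q w = dotv (H *m w) (pinvmx H *m (H *m w)).
  by rewrite dotv_mull Hsym (mulmxA (pinvmx H)) (mulmxA H) (mulmxA H) mulmxKpV.
apply: le_trans (cauchy_schwarz _ _) _.
by rewrite expr2 mulrCA ler_wpM2l ?enorm_ge0.
Qed.

Variables (F : 'cV[R]_n -> 'cV[R]_n) (a v : 'cV[R]_n) (c C lam : R).
Hypotheses (c0 : 0 < c) (C0 : 0 <= C) (lam0 : lam < 0) (v0 : v != 0).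
Hypothesis qv : q v = lam * enorm v ^+ 2.
Hypothesis energy : forall eta, 0 < eta -> exists2 r, 0 < r &
  forall x y, enorm (x - a) <= r -> enorm (y - a) <= r ->
  exists2 S, 0 <= S &
  [/\ q (F x - F y) <= q (x - y) - c * S + eta * enorm (x - y) ^+ 2,
      enorm (F x - F y - (x - y)) ^+ 2 <= C * S &
      enorm (H *m (x - y)) ^+ 2 <= C * S + eta * enorm (x - y) ^+ 2].

Lemma expanding_form : exists (kappa eps r : R), let Q w := q w + kappa * enorm w ^+ 2 in
  [/\ 0 < eps, 0 < r, Q v < 0 &
  forall x y, enorm (x - a) <= r -> enorm (y - a) <= r ->
    Q (F x - F y) <= (1 + eps) * Q (x - y)].
Proof.
have [C1 C10 hq] := sym_quad_le_image.
have c20 : 0 < c / 2 by rewrite divr_gt0.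
have [eps eps0 heps] := small_scale (mulr_ge0 C10 C0) c20.
have C20 : 0 <= (1 + 2 / eps) * C by rewrite mulr_ge0// addr_ge0// divr_ge0// ltW.
have [k1 k10 hk1] := small_scale C20 c20.
pose kappa := Num.min k1 (- lam / 2).
have kappa0 : 0 < kappa by rewrite lt_min k10 divr_gt0// oppr_gt0.
have hk : kappa * ((1 + 2 / eps) * C) <= c / 2.
  by apply: le_trans hk1; rewrite ler_wpM2r// ge_min lexx.
have klam : kappa <= - lam / 2 by rewrite ge_min lexx orbT.
have ke0 : 0 < kappa * eps / 2 by rewrite divr_gt0// mulr_gt0.
have D0 : 0 <= 1 + eps * C1 by rewrite addr_ge0// mulr_ge0// ltW.
have [eta eta0 heta] := small_scale D0 ke0.
have [r r0 hr] := energy eta0.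
exists kappa, eps, r => /=; split=> //.
  rewrite qv -mulrDl pmulr_llt0; first lra.
  by rewrite exprn_gt0// lt_neqAle enorm_ge0 andbT eq_sym enorm_eq0.
move=> x y xr yr; have [S S0] := hr x y xr yr.
have := enormD (F x - F y - (x - y)) (x - y); rewrite subrK.
have := hq (x - y); set q0 := q (x - y); set q1 := q (F x - F y).
set rho := enorm (_ - _ - _); set N := enorm (x - y); set N' := enorm (F x - F y).
set h := enorm (H *m _) => hq0 NN [e1 e2 e3].
have rho0 : 0 <= rho := enorm_ge0 _.
have N0 : 0 <= N := enorm_ge0 _.
have young : N' ^+ 2 <= (1 + eps / 2) * N ^+ 2 + (1 + 2 / eps) * rho ^+ 2.
  apply: (@le_trans _ _ ((rho + N) ^+ 2)).
    by rewrite ler_sqr ?nnegrE ?enorm_ge0 ?addr_ge0.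
  have : 0 <= (eps / 2) * (N - 2 / eps * rho) ^+ 2.
    by rewrite mulr_ge0 ?sqr_ge0// divr_ge0// ltW.
  have -> : (eps / 2) * (N - 2 / eps * rho) ^+ 2 =
      eps / 2 * N ^+ 2 - 2 * (N * rho) + 2 / eps * rho ^+ 2.
    by field; rewrite lt0r_neq0.
  by rewrite sqrrD; lra.
have A1 : - (eps * q0) <= eps * (C1 * (C * S + eta * N ^+ 2)).
  rewrite -mulrN ler_pM2l//; move: hq0; rewrite ler_norml => /andP[hq0 _].
  have := ler_wpM2l C10 e3; lra.
have A2 : eps * (C1 * C) * S <= c / 2 * S by rewrite ler_wpM2r.
have A3 : kappa * ((1 + 2 / eps) * C) * S <= c / 2 * S by rewrite ler_wpM2r.
have A4 : eta * (1 + eps * C1) * N ^+ 2 <= kappa * eps / 2 * N ^+ 2.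
  by rewrite ler_wpM2r ?sqr_ge0.
have A5 : kappa * N' ^+ 2 <= kappa * ((1 + eps / 2) * N ^+ 2 + (1 + 2 / eps) * (C * S)).
  rewrite ler_pM2l//; apply: le_trans young _; rewrite lerD2l ler_wpM2l//.
  by rewrite addr_ge0// divr_ge0// ltW.
move: A3 A5; move: (2 / eps) => ie A3 A5.
have E1 : kappa * ((1 + eps / 2) * N ^+ 2 + (1 + ie) * (C * S)) =
   kappa * N ^+ 2 + kappa * eps / 2 * N ^+ 2 + kappa * ((1 + ie) * C) * S by field.
rewrite {}E1 in A5.
have E2 : eps * (C1 * (C * S + eta * N ^+ 2)) =
   eps * (C1 * C) * S + eta * (eps * C1) * N ^+ 2 by ring.
rewrite {}E2 in A1.
lra.
Qed.

End Lyapunov.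

Section Trapped.
Variables (R : realType) (n : nat) (F : 'cV[R]_n -> 'cV[R]_n) (a : 'cV[R]_n).
Variables (M : 'M[R]_n) (eps r : R).
Let Q (w : 'cV[R]_n) := dotv w (M *m w).
Hypothesis eps0 : 0 < eps.
Hypothesis grow : forall x y, enorm (x - a) <= r -> enorm (y - a) <= r ->
  Q (F x - F y) <= (1 + eps) * Q (x - y).

Definition trapped : set 'cV[R]_n := [set x | forall k, enorm (iter k F x - a) <= r].

Lemma trapped_form_ge0 x y : trapped x -> trapped y -> 0 <= Q (x - y).
Proof.
move=> tx ty; rewrite leNgt; apply/negP => Qxy.
have [K K0 hK] := mulmx_bounded M.
have Qbnd k : - Q (iter k F x - iter k F y) <= K * (2 * r) ^+ 2.
  have w2r : enorm (iter k F x - iter k F y) <= 2 * r.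
    apply: le_trans (enorm_triangle a _ _) _; rewrite (enormBC a).
    have := tx k; have := ty k; lra.
  move: w2r; set w := _ - _ => w2r.
  apply: le_trans (ler_norm _) _; rewrite normrN.
  apply: le_trans (cauchy_schwarz _ _) _.
  apply: (@le_trans _ _ (K * enorm w ^+ 2)).
    by rewrite expr2 mulrCA ler_wpM2l ?enorm_ge0.
  by rewrite ler_wpM2l// ler_sqr ?nnegrE ?enorm_ge0// (le_trans (enorm_ge0 w)).
have Qgrow k : k%:R * eps * - Q (x - y) <= - Q (iter k F x - iter k F y) + Q (x - y)
             /\ Q (iter k F x - iter k F y) < 0.
  elim: k => [|k [IH1 IH2]]; first by rewrite !mul0r addNr.
  have := grow (tx k) (ty k) => /= g.
  have h1 : eps * - Q (x - y) <= eps * - Q (iter k F x - iter k F y).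
    rewrite ler_pM2l//; have : 0 <= k%:R * eps * - Q (x - y).
      by rewrite !mulr_ge0 ?oppr_ge0// ltW.
    lra.
  split.
    rewrite -natr1; lra.
  have : 0 < eps * - Q (x - y) by rewrite mulr_gt0// oppr_gt0.
  lra.
have e0 : 0 < eps * - Q (x - y) by rewrite mulr_gt0// oppr_gt0.
pose k := (Num.truncn (K * (2 * r) ^+ 2 / (eps * - Q (x - y)))).+1.
have : K * (2 * r) ^+ 2 / (eps * - Q (x - y)) < k%:R by exact: truncnS_gt.
rewrite ltr_pdivrMr// => kk.
have [g _] := Qgrow k; have := Qbnd k; rewrite mulrA in kk.
lra.
Qed.

End Trapped.

Section ContentNull.
Variable R : realType.
Implicit Types n : nat.

Definition content_null n (A : set 'cV[R]_n) := forall eps : R, 0 < eps ->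
  exists (I : finType) (cell : 'cV[R]_n -> I) (r : R),
  [/\ 0 < r, #|I|%:R * r ^+ n <= eps &
      forall x y, A x -> A y -> cell x = cell y -> enorm (x - y) <= r].

Lemma content_null_preimage n (A B : set 'cV[R]_n) (F : 'cV[R]_n -> 'cV[R]_n) C :
  0 <= C -> content_null B -> (forall x, A x -> B (F x)) ->
  (forall x y, A x -> A y -> enorm (x - y) <= C * enorm (F x - F y)) ->
  content_null A.
Proof.
move=> C0 nB AB AF eps eps0.
have C10 : 0 < C + 1 by rewrite ltr_wpDl.
have [I [cell [r [r0 vol sep]]]] := nB _ (divr_gt0 eps0 (exprn_gt0 n C10)).
exists I, (cell \o F), ((C + 1) * r); split; first exact: mulr_gt0.
  by rewrite exprMn mulrCA mulrC -ler_pdivlMr// exprn_gt0.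
move=> x y Ax Ay /= /sep H; apply: le_trans (AF _ _ Ax Ay) _.
apply: ler_pM => //; rewrite ?enorm_ge0 ?lerDl//.
by apply: H; apply: AB.
Qed.

Lemma cone_coef_le n (M : 'M[R]_n) (v : 'cV[R]_n) : dotv v (M *m v) < 0 ->
  exists2 K, 0 < K & forall t z,
    0 <= dotv (t *: v + z) (M *m (t *: v + z)) -> `|t| <= K * enorm z.
Proof.
set g := dotv v _ => g0.
have [B B0 hB] := mulmx_bounded M.
pose B1 := 2 * (B * enorm v) + B.
have B10 : 0 <= B1 by rewrite addr_ge0// mulr_ge0// mulr_ge0// enorm_ge0.
have K0 : 0 < B1 / - g + 1 by rewrite ltr_wpDl// divr_ge0// oppr_ge0 ltW.
exists (B1 / - g + 1) => // t z.
have -> : dotv (t *: v + z) (M *m (t *: v + z)) =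
    t ^+ 2 * g + t * (dotv v (M *m z) + dotv z (M *m v)) + dotv z (M *m z).
  rewrite mulmxDr -scalemxAr dotvDl !dotvDr !dotvZl !dotvZr -/g; ring.
move=> Q0; rewrite leNgt; apply/negP => tz.
set s := `|t| in tz; set e := enorm z in tz; set V := enorm v in B1 B10 K0 tz.
have e0 : 0 <= e := enorm_ge0 _.
have V0 : 0 <= V := enorm_ge0 _.
have s0 : 0 < s by apply: le_lt_trans tz; rewrite mulr_ge0// ltW.
have es : e <= s.
  apply: le_trans (ltW tz); rewrite ler_peMl// lerDr divr_ge0// oppr_ge0 ltW//.
have h1 : `|dotv v (M *m z)| <= B * V * e.
  apply: le_trans (cauchy_schwarz _ _) _.
  by rewrite (mulrC B) -mulrA ler_wpM2l ?enorm_ge0.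
have h2 : `|dotv z (M *m v)| <= B * V * e.
  apply: le_trans (cauchy_schwarz _ _) _.
  by rewrite (mulrC _ e) ler_wpM2l.
have h3 : dotv z (M *m z) <= B * e * e.
  by apply: le_trans (dotv_le _ _) _; rewrite (mulrC _ e) ler_wpM2l.
have h4 : t * (dotv v (M *m z) + dotv z (M *m v)) <= s * (2 * (B * V) * e).
  apply: le_trans (ler_norm _) _; rewrite normrM ler_wpM2l//.
  by apply: le_trans (ler_normD _ _) _; lra.
have h5 : B * e * e <= B * s * e by rewrite ler_wpM2r// ler_wpM2l.
have h6 : s * (- g * s) <= s * (B1 * e).
  have : t ^+ 2 = s ^+ 2 by rewrite real_normK ?num_real.
  by move: Q0; rewrite /B1 => Q0 tE; rewrite tE in Q0; lra.
rewrite ler_pM2l// in h6.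
have g'0 : 0 < - g by rewrite oppr_gt0.
move: tz; rewrite -(ltr_pM2l g'0).
have -> : - g * ((B1 / - g + 1) * e) = B1 * e + - g * e.
  by field; rewrite lt_eqF.
have : 0 <= - g * e by rewrite mulr_ge0// ltW.
lra.
Qed.

Lemma truncn_close (s t : R) : 0 <= s -> 0 <= t ->
  Num.truncn s = Num.truncn t -> `|s - t| <= 1.
Proof.
move=> s0 t0 E; have := truncn_le s; have := truncn_le t.
have := truncnS_gt s; have := truncnS_gt t; rewrite s0 t0 E -natr1.
by move=> *; rewrite ler_norml; apply/andP; split; lra.
Qed.

Lemma content_null_cone n (A : set 'cV[R]_n) (M : 'M[R]_n) (v : 'cV[R]_n) b :
  (forall x, A x -> enorm x <= b) -> dotv v (M *m v) < 0 ->
  (forall x y, A x -> A y -> 0 <= dotv (x - y) (M *m (x - y))) ->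
  content_null A.
Proof.
case: n A M v => [|n] A M v Ab Qv AQ; first by rewrite /dotv big_ord0 ltxx in Qv.
have [i vi] : exists i, v i 0 != 0.
  apply/existsP; rewrite -negb_forall; apply/negP => /forallP v0.
  suff v0' : v = 0 by rewrite v0' dotv0l ltxx in Qv.
  by apply/colP => i; rewrite mxE; apply/eqP.
have [K K0 hK] := cone_coef_le Qv.
pose proj (x : 'cV[R]_n.+1) := x - (x i 0 / v i 0) *: v.
have proji x : proj x i 0 = 0 by rewrite !mxE divfK// subrr.
pose P := `|b| * (1 + enorm v / `|v i 0|) + 1.
have P0 : 0 < P.
  by rewrite ltr_wpDl// mulr_ge0// addr_ge0// divr_ge0// enorm_ge0.
have projP x j : A x -> - P <= proj x j 0 <= P.
  move=> Ax; rewrite -ler_norml; apply: le_trans (coord_le_enorm _ _) _.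
  apply: le_trans (enormB _ _) _; rewrite enormZ normrM normfV.
  have xb : enorm x <= `|b| := le_trans (Ab _ Ax) (ler_norm _).
  have : `|x i 0| / `|v i 0| * enorm v <= `|b| * (enorm v / `|v i 0|).
    rewrite -mulrA (mulrC _^-1) ler_wpM2r ?divr_ge0 ?enorm_ge0//.
    exact: le_trans (coord_le_enorm _ _) xb.
  by rewrite /P; lra.
pose C1 := (K * enorm v + 1) * n.+1%:R * (2 * P).
have C10 : 0 < C1.
  by rewrite !mulr_gt0 ?ltr0n// ltr_wpDl// mulr_ge0 ?enorm_ge0// ltW.
move=> eps eps0.
pose N := (Num.truncn (2 ^+ n * C1 ^+ n.+1 / eps)).+1.
have NR0 : 0 < N%:R :> R by rewrite ltr0n.
pose h := 2 * P / N%:R.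
have h0 : 0 < h by rewrite divr_gt0// mulr_gt0.
pose idx x j := Num.truncn ((proj x (lift i j) 0 + P) / h).
have idx0 x j : A x -> 0 <= (proj x (lift i j) 0 + P) / h.
  move=> Ax; have /andP[Px _] := projP x (lift i j) Ax; rewrite divr_ge0// ?(ltW h0)//; lra.
have idxN x j : A x -> (idx x j < N.+1)%N.
  move=> Ax; have /andP[_ Px] := projP x (lift i j) Ax.
  rewrite ltnS -(ler_nat R); apply: (@le_trans _ _ ((proj x (lift i j) 0 + P) / h)).
    by rewrite truncn_le idx0.
  by rewrite ler_pdivrMr// /h mulrC divfK ?lt0r_neq0//; lra.
exists {ffun 'I_n -> 'I_N.+1}, (fun x => [ffun j => inord (idx x j)]), (C1 / N%:R).
split; first exact: divr_gt0.
  rewrite card_ffun !card_ord natrX expr_div_n mulrA ler_pdivrMr ?exprn_gt0//.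
  have N2 : N.+1%:R <= 2 * N%:R :> R by rewrite -natrM ler_nat mul2n -addnn /N; lia.
  apply: (@le_trans _ _ ((2 * N%:R) ^+ n * C1 ^+ n.+1)).
    by rewrite ler_wpM2r ?exprn_ge0 ?(ltW C10)// lerXn2r// nnegrE.
  rewrite exprMn (exprS N%:R) mulrA mulrAC ler_wpM2r ?exprn_ge0//.
  have : 2 ^+ n * C1 ^+ n.+1 / eps < N%:R by exact: truncnS_gt.
  by rewrite ltr_pdivrMr// (mulrC N%:R) => /ltW.
move=> x y Ax Ay /ffunP cxy.
have close j : `|(proj x - proj y) j 0| <= h.
  have [k ->|->] := unliftP i j; last first.
    by rewrite [X in `|X|]mxE [X in `|_ + X|]mxE !proji subrr normr0 ltW.
  have := cxy k; rewrite !ffunE => /(congr1 val)/=; rewrite !inordK ?idxN// => E.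
  have := truncn_close (idx0 x k Ax) (idx0 y k Ay) E.
  rewrite -mulrBl opprD addrACA subrr addr0 normrM normfV (gtr0_norm h0).
  by rewrite ler_pdivrMr// mul1r [X in _ -> `|X| <= _]mxE [X in _ -> `|_ + X| <= _]mxE.
have zh := enorm_le_coord (ltW h0) close.
set z := proj x - proj y in zh; pose t := (x i 0 - y i 0) / v i 0.
have E : x - y = t *: v + z.
  by apply/colP => j; rewrite /z /t /proj !mxE; field.
have := AQ _ _ Ax Ay; rewrite E => /hK tz.
apply: le_trans (enormD _ _) _; rewrite enormZ.
have : `|t| * enorm v <= K * enorm z * enorm v by rewrite ler_wpM2r ?enorm_ge0.
have : (K * enorm v + 1) * enorm z <= (K * enorm v + 1) * (n.+1%:R * h).
  by rewrite ler_wpM2l// addr_ge0// mulr_ge0 ?enorm_ge0// ltW.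
have -> : C1 / N%:R = (K * enorm v + 1) * (n.+1%:R * h) by rewrite /C1 /h !mulrA.
lra.
Qed.

End ContentNull.

Section LebesgueNull.
Variables (R : realType) (n : nat).

Lemma content_null_lebesgue (A : set 'cV[R]_n) : (0 < n)%N -> content_null A ->
  lebesgue_null [set x : n.-tuple R | A (tup2cv x)].
Proof.
move=> n0 nA eps eps0.
have p2 : 0 < 2 ^+ n :> R by rewrite exprn_gt0.
have [I [cell [r [r0 vol sep]]]] := nA _ (divr_gt0 eps0 p2).
pose ctr (i : 'I_#|I|) := xget (0 : 'cV[R]_n) [set x | A x /\ cell x = enum_val i].
pose corner (s : R) (k : nat) : n.-tuple R :=
  if insub k is Some i then [tuple ctr i j 0 + s | j < n] else [tuple 0 | j < n].
exists (corner (- r)), (corner r); split.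
- move=> k j; rewrite /corner; case: insubP => [i _ _|_]; rewrite !tnth_mktuple//.
  lra.
- move=> x /= Ax; pose i := enum_rank (cell (tup2cv x)).
  exists (val i) => // j; rewrite /corner; case: insubP => [i' _ /val_inj ->|]; last first.
    by rewrite ltn_ord.
  rewrite !tnth_mktuple.
  have [Ac cc] : [set y | A y /\ cell y = enum_val i] (ctr i).
    rewrite /ctr; case: xgetP => [y -> //|/(_ (tup2cv x))[]].
    by split=> //; rewrite enum_rankK.
  have := sep _ _ Ac Ax; rewrite cc enum_rankK => /(_ erefl).
  move=> /(le_trans (coord_le_enorm _ j)); rewrite !mxE ler_norml => /andP[h1 h2].
  by apply/andP; split; lra.
set V := (2 * r) ^+ n.
have volE k : boxvol (corner (- r) k) (corner r k) = if (k < #|I|)%N then V else 0.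
  rewrite /boxvol /corner; case: insubP => [i -> _|/negbTE ->].
    rewrite (eq_bigr (fun=> 2 * r)) => [|j _]; last by rewrite !tnth_mktuple; ring.
    by rewrite prodr_const card_ord.
  by rewrite (bigD1 (Ordinal n0))//= !tnth_mktuple subrr mul0r.
have V0 : 0 <= V by rewrite exprn_ge0// mulr_ge0// ltW.
have V0' k : (0 <= (boxvol (corner (- r) k) (corner r k))%:E)%E.
  by rewrite lee_fin volE; case: ifP.
apply: lime_le; first by apply: is_cvg_nneseries => k _ _; exact: V0'.
near=> m; rewrite sumEFin lee_fin.
rewrite (_ : \sum_(0 <= k < m) _ = (minn m #|I|)%:R * V); last first.
  elim: (m : nat) => [|k IH]; first by rewrite big_nil min0n mul0r.
  rewrite big_nat_recr//= IH volE; case: ifPn; rewrite -?leqNgt => kI.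
    by rewrite (minn_idPl kI) (minn_idPl (ltnW kI)) -natr1 mulrDl mul1r.
  by rewrite addr0 (minn_idPr kI) (minn_idPr (leqW kI)).
apply: (@le_trans _ _ (#|I|%:R * V)); first by rewrite ler_wpM2r// ler_nat geq_minr.
by rewrite /V exprMn mulrCA mulrC -ler_pdivlMr.
Unshelve. all: by end_near. Qed.

Lemma measurable_box (a b : n.-tuple R) : measurable (box a b).
Proof.
rewrite (_ : box a b =
  \bigcap_(i in [set: 'I_n]) ((fun x => tnth x i) @^-1` `[tnth a i, tnth b i])).
  apply: fin_bigcap_measurable => // i _.
  by rewrite -[X in measurable X]setTI; apply: measurable_tnth.
apply/seteqP; split => x /= H i; first by move=> _ /=; rewrite in_itv/= H.
by have := H i I; rewrite /= in_itv.
Qed.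

Lemma lebesgue_null_negligible (nu : probability (n.-tuple R) R) A :
  abs_cont_lebesgue nu -> lebesgue_null A -> nu.-negligible A.
Proof.
move=> ac nA.
have /choice[ab hab] (k : nat) : exists ab : (nat -> n.-tuple R) * (nat -> n.-tuple R),
    [/\ (forall j i, tnth (ab.1 j) i <= tnth (ab.2 j) i),
        A `<=` \bigcup_j box (ab.1 j) (ab.2 j) &
        (\sum_(0 <= j <oo) (boxvol (ab.1 j) (ab.2 j))%:E <= (k.+1%:R^-1)%:E)%E].
  have k0 : 0 < k.+1%:R^-1 :> R by rewrite invr_gt0 ltr0n.
  by have [a [b H]] := nA _ k0; exists (a, b).
pose N := \bigcap_k \bigcup_j box ((ab k).1 j) ((ab k).2 j).
exists N; split.
- apply: bigcapT_measurable => k; apply: bigcupT_measurable => j.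
  exact: measurable_box.
- apply: ac.
    apply: bigcapT_measurable => k; apply: bigcupT_measurable => j.
    exact: measurable_box.
  move=> eps eps0; pose k := Num.truncn eps^-1; have [h1 h2 h3] := hab k.
  exists (ab k).1, (ab k).2; split=> //; first by move=> x /(_ k I).
  apply: le_trans h3 _; rewrite lee_fin -[leRHS]invrK lef_pV2 ?posrE ?invr_gt0//.
  exact/ltW/truncnS_gt.
by move=> x Ax k _; have [_ h _] := hab k; apply: h.
Qed.

End LebesgueNull.

Section Saddle.
Variables (R : realType) (n : nat).

Lemma lambda_min_lt0 (H : 'M[R]_n) : lambda_min H < 0 ->
  exists (lam : R) (v : 'cV[R]_n),
    [/\ lam < 0, v != 0 & dotv v (H *m v) = lam * enorm v ^+ 2].
Proof.
move=> H0.
have [lam /eigenvalueP[w wH w0] lam0] : exists2 lam, eigenvalue H lam & lam < 0.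
  apply: contrapT => noneg; move: H0; rewrite ltNge => /negP; apply.
  rewrite /lambda_min; set E := [set _ | _].
  have [->|/set0P E0] := eqVneq E set0; first by rewrite inf0.
  apply: lb_le_inf => // lam /= Elam; rewrite leNgt; apply/negP => lam0.
  by apply: noneg; exists lam.
exists lam, w^T; split=> //; first by rewrite -trmx0 (inj_eq trmx_inj).
rewrite enorm_sqr !dotvE trmxK mulmxA wH -scalemxAl.
by rewrite mxE.
Qed.

Lemma iter_locally_lipschitz (F : 'cV[R]_n -> 'cV[R]_n) k :
  locally_lipschitz F -> locally_lipschitz (iter k F).
Proof.
move=> lF; elim: k => [r|k IH]; first by exists 1 => // x y; rewrite mul1r.
exact: locally_lipschitz_comp IH lF.
Qed.

Lemma iter_locally_expanding (F : 'cV[R]_n -> 'cV[R]_n) k :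
  locally_lipschitz F -> locally_expanding F -> locally_expanding (iter k F).
Proof.
move=> lF eF; elim: k => [r|k IH]; first by exists 1 => // x y; rewrite mul1r.
exact: locally_expanding_comp (iter_locally_lipschitz k lF) IH eF.
Qed.

Lemma form_shift (H : 'M[R]_n) kappa (w : 'cV[R]_n) :
  dotv w ((H + kappa%:M) *m w) = dotv w (H *m w) + kappa * enorm w ^+ 2.
Proof. by rewrite mulmxDl dotvDr mul_scalar_mx dotvZr enorm_sqr. Qed.

End Saddle.

Section StableSet.
Variables (R : realType) (n : nat) (F : 'cV[R]_n -> 'cV[R]_n) (a : 'cV[R]_n) (r : R).
Variable nu : probability (n.-tuple R) R.
Hypotheses (n0 : (0 < n)%N) (r0 : 0 < r) (ac : abs_cont_lebesgue nu).
Hypotheses (lF : locally_lipschitz F) (eF : locally_expanding F).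
Hypothesis nW : content_null (trapped F a r).

Lemma stable_set_negligible :
  nu.-negligible [set x0 : n.-tuple R | (fun k => iter k F (tup2cv x0)) @ \oo --> a].
Proof.
pose A (k j : nat) : set 'cV[R]_n :=
  [set x | enorm x <= j%:R /\ trapped F a r (iter k F x)].
apply: (@negligibleS _ _ _ nu
    (\bigcup_k \bigcup_j [set x : n.-tuple R | A k j (tup2cv x)])); last first.
  apply: negligible_bigcup => k; apply: negligible_bigcup => j.
  apply: lebesgue_null_negligible => //; apply: content_null_lebesgue => //.
  have [C C0 hC] := iter_locally_expanding k lF eF j%:R.
  apply: (content_null_preimage C0 nW (F := iter k F)) => [x []//|x y [xj _] [yj _]].
  exact: hC.
move=> x0 /= cvg; set x := tup2cv x0.
have rn0 : 0 < r / n%:R by rewrite divr_gt0// ltr0n.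
have /cvgrPdist_le/(_ _ rn0)[k _ hk] := cvg.
exists k => //; exists (Num.truncn (enorm x)).+1 => //; split.
  exact/ltW/truncnS_gt.
move=> j; rewrite -iterD enormBC; apply: le_trans (enorm_le_mx_norm _) _.
by rewrite mulrC -ler_pdivlMr ?ltr0n//; apply: hk; rewrite /= leq_addl.
Qed.

End StableSet.

Unset Implicit Arguments.

Theorem theorem4 (R : realType) (p : nat) (ns : 'I_p -> nat)
  (f : 'cV[R]_(dimn ns) -> R) (L : R)
  (phi : forall t : 'I_p, 'cV[R]_(ns t) -> R) (mus : 'I_p -> R)
  (alpha : R) (xstar : 'cV[R]_(dimn ns))
  (nu : probability ((dimn ns).-tuple R) R) :
  C2 f -> 0 < L -> lipschitz_grad f L ->
  (forall t, C2 (phi t)) ->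
  (forall t, 0 < mus t) ->
  (forall t, strongly_convex (phi t) (mus t)) ->
  strict_saddle f xstar ->
  0 < alpha -> alpha < inf [set mus t | t in [set: 'I_p]] / L ->
  abs_cont_lebesgue nu ->
  nu.-negligible
    [set x0 : (dimn ns).-tuple R |
      bmd_iter f phi alpha (tup2cv x0) @ \oo --> xstar].
Proof.
move=> f2 L0 flip phi2 mu0 sc [fx Hneg] alpha0 alphaLt ac.
have alphaL t : alpha * L < mus t.
  rewrite ltr_pdivlMr// in alphaLt; apply: (lt_le_trans alphaLt).
  by apply: ge_inf; [exists 0 => _ [s _ <-]; apply: ltW | exists t].
have [lam [v [lam0 v0 qv]]] := lambda_min_lt0 Hneg.
have n0 : (0 < dimn ns)%N.
  rewrite lt0n; apply: contraNneq v0 => n0.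
  by apply/eqP/colP => i; have := ltn_ord i; rewrite [X in (_ < X)%N]n0.
set F := bmd_step f phi alpha.
have lF : locally_lipschitz F.
  exact: (sweep_locally_lipschitz L0 flip phi2 mu0 sc alpha0 (enum 'I_p)).
have eF : locally_expanding F.
  exact: (sweep_locally_expanding L0 flip phi2 mu0 sc alpha0 alphaL (enum 'I_p)).
have [C C0 hC] := sweep_energy f2 L0 flip phi2 mu0 sc alpha0 alphaL fx (enum 'I_p).
have [||kappa [eps [r [eps0 r0 Qv grow]]]] :=
  @expanding_form R (dimn ns) (hess f xstar) (hess_sym _ f2) F xstar v (L / 2)
    ((dimn ns).+1%:R * C) lam (divr_gt0 L0 (ltr0n _ 2)) _ lam0 v0 qv.
- by rewrite mulr_ge0.
- move=> eta eta0.
  have N0 : 0 < (dimn ns).+1%:R :> R by rewrite ltr0n.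
  have [r r0 hr] := hC _ (divr_gt0 eta0 N0).
  exists r => // x y xr yr; have [S S0 [q1 n1 u1]] := hr x y xr yr.
  have eta1 : eta / (dimn ns).+1%:R <= eta.
    by rewrite ler_pdivrMr// ler_pMr// ler1n.
  exists S => //; split.
  + by apply: le_trans q1 _; rewrite lerD2l ler_wpM2r ?sqr_ge0.
  + by apply: le_trans n1 _; rewrite ler_wpM2r// ler_peMl// ler1n.
  have {}u1 t := u1 t (mem_enum _ t).
  apply: le_trans (enorm_sqr_le_blocks u1) _.
  apply: (@le_trans _ _ ((dimn ns).+1%:R *
    (C * S + eta / (dimn ns).+1%:R * enorm (x - y) ^+ 2))).
    rewrite ler_wpM2r ?ler_nat//; apply: addr_ge0; apply: mulr_ge0 => //.
      exact: ltW (divr_gt0 eta0 N0).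
    exact: sqr_ge0.
  by rewrite mulrDr !mulrA (mulrC _ eta) mulfK// lt0r_neq0.
have W0 : content_null (trapped F xstar r).
  apply: (@content_null_cone _ _ _ (hess f xstar + kappa%:M) v (enorm xstar + r)).
  - by move=> x /(_ 0%N); apply: ball_enorm_le.
  - by rewrite form_shift.
  apply: (trapped_form_ge0 eps0) => x y xr yr; rewrite !form_shift; exact: grow.
exact: (stable_set_negligible n0 r0 ac lF eF W0).
Qed.
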